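(* Let $\mathfrak{A}$ be a bornological algebra. The map $$\ell^\infty(\mathfrak{A})\#_{\mathcal{P}}\Gamma\to\Gamma^\infty(\mathfrak{A}),\qquad \alpha\#U_f\mapsto\mathrm{diag}(\alpha)U_f$$ is an isomorphism of $\mathcal{P}$-algebras. If $S\triangleleft\ell^\infty$ is a symmetric ideal, then this map sends $S(\mathfrak{A})\#_{\mathcal{P}}\Gamma$ isomorphically onto $I_{S(\mathfrak{A})}\triangleleft\Gamma^\infty(\mathfrak{A})$.
   Context: A (complete, convex) bornological vector space over $\mathbb{C}$ is a filtering union $\mathbb{V}=\bigcup_D\mathbb{V}_D$ of Banach spaces, indexed by its disks $D$, with bounded inclusions; $\|\cdot\|_D$ is the norm of $\mathbb{V}_D$. A bornological algebra is a bornological vector space with an associative bounded multiplication (not necessarily unital). $\mathrm{Emb}$ is the monoid of partially defined injections $f:\mathrm{dom}(f)\to\mathbb{N}$, $\mathrm{dom}(f)\subset\mathbb{N}$, with inverse $f^\dagger:\mathrm{ran}(f)\to\mathbb{N}$; it acts on bounded sequences by $f_*(\alpha)_n=\alpha_{f^\dagger(n)}$ if $n\in\mathrm{ran}(f)$, $0$ otherwise. $2^{\mathbb{N}}\subset\mathrm{Emb}$ is the submonoid of idempotents, i.e. of inclusions $P_A:A\hookrightarrow\mathbb{N}$, $A\subset\mathbb{N}$, identified with characteristic functions $\chi_A$. An ideal $S\triangleleft\ell^\infty$ is symmetric if it is $\mathrm{Emb}$-invariant. For a countably infinite set $X$, $S(X)$ is obtained from $S$ by transport along a bijection $\mathbb{N}\to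 X$, and $S(X,\mathfrak{A})$ is the set of families $(a_x)_{x\in X}$ contained in some $\mathfrak{A}_D$ with $(\|a_x\|_D)_x\in S(X)$; $S(\mathfrak{A})=S(\mathbb{N},\mathfrak{A})$. For a matrix $A$ indexed by $\mathbb{N}\times\mathbb{N}$, $N(A)$ is the supremum of the numbers of nonzero entries in its rows and columns. $I_{S(\mathfrak{A})}$ is the algebra of matrices $A\in\mathfrak{A}^{\mathbb{N}\times\mathbb{N}}$ with $(A_{ij})\in S(\mathbb{N}\times\mathbb{N},\mathfrak{A})$ and $N(A)<\infty$; $\Gamma^\infty(\mathfrak{A})=I_{\ell^\infty(\mathfrak{A})}$. $\Gamma=\{A\in\mathbb{Z}^{\mathbb{N}\times\mathbb{N}}:N(A)<\infty,\ \{A_{ij}\}\text{ finite}\}$. $U_f\in\Gamma$ has $(i,j)$ entry $1$ if $f(j)=i$ and $0$ otherwise; $\Gamma$ is spanned over $\mathbb{Z}$ by the $U_f$. $\mathcal{P}=\mathrm{span}_{\mathbb{Z}}\{U_p:p\in2^{\mathbb{N}}\}\subset\Gamma$. $\mathrm{diag}(\alpha)U_f$ is the matrix with $(i,j)$ entry $\alpha_i$ if $f(j)=i$ and $0$ otherwise. $S(\mathfrak{A})$ is a central $\mathcal{P}$-bimodule via $U_p\cdot\alpha=\alpha\cdot U_p=p_*(\alpha)$. The crossed product $S(\mathfrak{A})\#_{\mathcal{P}}\Gamma$ is $S(\mathfrak{A})\otimes_{\mathcal{P}}\Gamma$ (writing $\#$ for $\otimes$) with product determined by $(\alpha\#U_f)(\beta\#U_g)=\alpha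 f_*(\beta)\#U_{fg}$. A $\mathcal{P}$-algebra is a ring which is also a $\mathcal{P}$-bimodule with $(ap)b=a(pb)$ for ring elements $a,b$ and $p\in\mathcal{P}$ and compatible multiplication. *)

(* Defs.v *)
From HB Require Import structures.
From mathcomp Require Import all_boot all_order all_algebra finmap.
From mathcomp Require Import boolp classical_sets functions cardinality fsbigop.
From mathcomp Require Import reals topology normedtype complex.

Set Implicit Arguments.
Unset Strict Implicit.
Unset Printing Implicit Defensive.

Import Order.TTheory GRing.Theory Num.Theory.
Import numFieldNormedType.Exports.
Local Open Scope classical_set_scope.
Local Open Scope card_scope.
Local Open Scope ring_scope.

Definition biadditive (U V W : zmodType) (m : U -> V -> W) : Prop :=
  (forall u u' v, m (u + u') v = m u v + m u' v) /\
  (forall u v v', m u (v + v') = m u v + m u v').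

Section Biadditive.
Variables (U V W : zmodType) (m : U -> V -> W).
Hypothesis mb : biadditive m.

Lemma bi0l v : m 0 v = 0.
Proof. by apply: (addrI (m 0 v)); rewrite -mb.1 !addr0. Qed.
Lemma bi0r u : m u 0 = 0.
Proof. by apply: (addrI (m u 0)); rewrite -mb.2 !addr0. Qed.
Lemma biNl u v : m (- u) v = - m u v.
Proof. by apply: (addrI (m u v)); rewrite -mb.1 !subrr bi0l. Qed.
Lemma biNr u v : m u (- v) = - m u v.
Proof. by apply: (addrI (m u v)); rewrite -mb.2 !subrr bi0r. Qed.
Lemma bisuml I (r : seq I) (F : I -> U) v :
  m (\sum_(i <- r) F i) v = \sum_(i <- r) m (F i) v.
Proof.
by elim: r => [|i r IH]; rewrite ?big_nil ?bi0l // !big_cons mb.1 IH.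
Qed.
Lemma bisumr I (r : seq I) (F : I -> V) u :
  m u (\sum_(i <- r) F i) = \sum_(i <- r) m u (F i).
Proof.
by elim: r => [|i r IH]; rewrite ?big_nil ?bi0r // !big_cons mb.2 IH.
Qed.
Lemma biMnl u v n : m (u *+ n) v = m u v *+ n.
Proof. by elim: n => [|n IH]; rewrite ?mulr0n ?bi0l // !mulrS mb.1 IH. Qed.
Lemma biMnr u v n : m u (v *+ n) = m u v *+ n.
Proof. by elim: n => [|n IH]; rewrite ?mulr0n ?bi0r // !mulrS mb.2 IH. Qed.
Lemma biMzl u v z : m (u *~ z) v = m u v *~ z.
Proof. by case: z => n; rewrite -?pmulrn ?NegzE ?mulrNz ?biNl -?pmulrn ?biMnl. Qed.
Lemma biMzr u v z : m u (v *~ z) = m u v *~ z.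
Proof. by case: z => n; rewrite -?pmulrn ?NegzE ?mulrNz ?biNr -?pmulrn ?biMnr. Qed.
End Biadditive.

Definition zspan (G : zmodType) (X : set G) : set G :=
  [set x | exists2 s : seq (int * G),
     (forall y, y \in s -> X y.2) & x = \sum_(y <- s) y.2 *~ y.1].

Lemma zspan_ind (G : zmodType) (X : set G) (P : G -> Prop) :
  P 0 -> (forall x y, P x -> P y -> P (x - y)) -> (forall x, X x -> P x) ->
  forall x, zspan X x -> P x.
Proof.
move=> P0 PB PX x [s sX ->].
have PN y : P y -> P (- y) by move=> Py; rewrite -[- y]add0r; apply: PB.
have PD y z : P y -> P z -> P (y + z).
  by move=> Py Pz; rewrite -[z]opprK; apply: PB => //; apply: PN.
have Pn y n : P y -> P (y *+ n).
  by move=> Py; elim: n => [|n IH]; rewrite ?mulr0n // mulrS; apply: PD.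
elim: s sX => [|[z y] s IH] sX; first by rewrite big_nil.
rewrite big_cons; apply: PD; last by apply: IH => w ws; apply: sX; rewrite inE ws orbT.
have Py : P y by apply/PX/(sX (z, y)); rewrite inE eqxx.
by case: z {sX} => n /=; rewrite -?pmulrn ?NegzE ?mulrNz -?pmulrn; [|apply: PN]; apply: Pn.
Qed.

Lemma zspan0 (G : zmodType) (X : set G) : zspan X 0.
Proof. by exists [::]; rewrite ?big_nil. Qed.

Lemma zspanN (G : zmodType) (X : set G) x : zspan X x -> zspan X (- x).
Proof.
case=> s sX ->; exists [seq (- y.1, y.2) | y <- s].
  by move=> _ /mapP[y ys ->] /=; apply: sX.
by rewrite big_map -sumrN; apply: eq_bigr => y _; rewrite mulrNz.
Qed.

Lemma zspanD (G : zmodType) (X : set G) x y :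
  zspan X x -> zspan X y -> zspan X (x + y).
Proof.
move=> [s sX ->] [t tX ->]; exists (s ++ t); last by rewrite big_cat.
by move=> z; rewrite mem_cat => /orP[/sX|/tX].
Qed.

Lemma zspan_gen (G : zmodType) (X : set G) x : X x -> zspan X x.
Proof.
move=> Xx; exists [:: (1, x)]; last by rewrite big_seq1.
by move=> y; rewrite inE => /eqP ->.
Qed.

Lemma zspan_sum (G : zmodType) (X : set G) I (r : seq I) (F : I -> G) :
  (forall i, zspan X (F i)) -> zspan X (\sum_(i <- r) F i).
Proof.
by move=> h; elim/big_ind: _ => // [|x y]; [apply: zspan0|apply: zspanD].
Qed.

Section FinN.
Variable V : zmodType.
Implicit Types A B : nat -> nat -> V.

(* N(A) <= n *)
Definition nnz_le A (n : nat) : Prop := forall i,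
  ([set j | A i j != 0] #<= `I_n) /\ ([set j | A j i != 0] #<= `I_n).

(* N(A) < oo *)
Definition nnz_finite A : Prop := exists n, nnz_le A n.

Lemma nnz_finiteP A : nnz_finite A <->
  exists n (r c : nat -> seq nat),
    (forall i, size (r i) <= n /\ size (c i) <= n)%N /\
    (forall i j, A i j != 0 -> j \in r i /\ i \in c j).
Proof.
split=> [[n An]|[n [r [c [szn Arc]]]]].
  exists n, (fun i => fset_set [set j | A i j != 0]),
    (fun j => fset_set [set i | A i j != 0]); split=> [i|i j Aij].
    by split; apply: geq_card_fset_set; case: (An i).
  split; rewrite in_fset_set ?inE //; apply/finite_set_leP; exists n.
  - by case: (An i).
  - by case: (An j).
have le (X : set nat) (s : seq nat) : (size s <= n)%N ->
    (forall j, X j -> j \in s) -> X #<= `I_n.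
  move=> sn Xs; apply/(@card_le_trans _ _ _ [set` s]); first exact: subset_card_le.
  apply: (@card_le_trans _ _ _ `I_(size s)); last by rewrite card_le_II.
  have -> : [set` s] = nth 0%N s @` `I_(size s).
    apply/seteqP; split=> [j /= js|_ [k /= ks <-]]; last exact: mem_nth.
    by exists (index j s); rewrite /= ?index_mem // nth_index.
  exact: card_image_le.
exists n => i; have [ri ci] := szn i.
by split; [apply: (le _ (r i))|apply: (le _ (c i))] => // j /Arc[].
Qed.

Lemma nnz_finite0 : nnz_finite 0.
Proof.
apply/nnz_finiteP; exists 0%N, (fun=> [::]), (fun=> [::]); split=> // i j.
by rewrite eqxx.
Qed.

Lemma nnz_finiteB A B : nnz_finite A -> nnz_finite B -> nnz_finite (A - B).
Proof.
move=> /nnz_finiteP[n [r [c [sz h]]]] /nnz_finiteP[n' [r' [c' [sz' h']]]].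
apply/nnz_finiteP; exists (n + n')%N, (fun i => r i ++ r' i), (fun i => c i ++ c' i).
split=> [i|i j]; first by rewrite !size_cat !leq_add //; case: (sz i); case: (sz' i).
rewrite !mem_cat; case: (eqVneq (A i j) 0) => [A0|/h[-> ->] //].
case: (eqVneq (B i j) 0) => [B0|/h'[-> ->]]; last by rewrite !orbT.
by rewrite !fctE A0 B0 subrr eqxx.
Qed.
End FinN.

Lemma nnz_finite_sub (V W : zmodType) (A : nat -> nat -> V) (B : nat -> nat -> W) :
  (forall i j, B i j != 0 -> A i j != 0) -> nnz_finite A -> nnz_finite B.
Proof.
move=> BA /nnz_finiteP[n [r [c [sz h]]]]; apply/nnz_finiteP.
by exists n, r, c; split=> // i j /BA /h.
Qed.

(* Matrix product relative to a pairing [m]; all sums are finitely supported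
   as soon as [nnz_finite A]. *)
Definition mxmul (U V W : zmodType) (m : U -> V -> W)
    (A : nat -> nat -> U) (B : nat -> nat -> V) : nat -> nat -> W :=
  fun i k => \sum_(j \in [set: nat]) m (A i j) (B j k).

Section Mxmul.
Variables (U V W : zmodType) (m : U -> V -> W).
Hypothesis mb : biadditive m.

Lemma mxmulE A B (s : seq nat) i k : uniq s -> (forall j, A i j != 0 -> j \in s) ->
  mxmul m A B i k = \sum_(j <- s) m (A i j) (B j k).
Proof.
move=> us sA; rewrite fsbig_seq // /mxmul; apply/esym/fsbig_widen => // j [_ js] /=.
have [->|/sA] := eqVneq (A i j) 0; first by rewrite (bi0l mb).
by move=> js'; case: js.
Qed.

Lemma nnz_rows (T : zmodType) (A : nat -> nat -> T) : nnz_finite A ->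
  exists r : nat -> seq nat, forall i, uniq (r i) /\ forall j, A i j != 0 -> j \in r i.
Proof.
move=> /nnz_finiteP[n [r [c [_ h]]]]; exists (fun i => undup (r i)) => i.
by rewrite undup_uniq; split=> // j /h[]; rewrite mem_undup.
Qed.

Lemma mxmulDl A A' B : nnz_finite A -> nnz_finite A' ->
  mxmul m (A + A') B = mxmul m A B + mxmul m A' B.
Proof.
move=> /nnz_rows[r h] /nnz_rows[r' h']; apply/funext => i; apply/funext => k.
set s := undup (r i ++ r' i).
have us : uniq s by apply: undup_uniq.
have sr j : A i j != 0 -> j \in s.
  by move=> /(h i).2; rewrite mem_undup mem_cat => ->.
have sr' j : A' i j != 0 -> j \in s.
  by move=> /(h' i).2; rewrite mem_undup mem_cat orbC => ->.
rewrite !fctE !(mxmulE _ _ us) // -?big_split /=.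
  by apply: eq_bigr => j _; rewrite mb.1.
move=> j; have [A0|/sr //] := eqVneq (A i j) 0.
have [A'0|/sr' //] := eqVneq (A' i j) 0.
by rewrite !fctE A0 A'0 addr0 eqxx.
Qed.

Lemma mxmulDr A B B' : nnz_finite A ->
  mxmul m A (B + B') = mxmul m A B + mxmul m A B'.
Proof.
move=> /nnz_rows[r h]; apply/funext => i; apply/funext => k.
have [ur rA] := h i; rewrite !fctE !(mxmulE _ _ ur) // -big_split.
by apply: eq_bigr => j _; rewrite /= -mb.2.
Qed.

Lemma nnz_finite_mul A B : nnz_finite A -> nnz_finite B ->
  nnz_finite (mxmul m A B).
Proof.
move=> nA nB; have [r0 h0] := nnz_rows nA; move: nA nB.
move=> /nnz_finiteP[n [r [c [sz h]]]] /nnz_finiteP[n' [r' [c' [sz' h']]]].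
apply/nnz_finiteP; exists (n * n')%N, (fun i => flatten [seq r' j | j <- r i]),
  (fun k => flatten [seq c j | j <- c' k]); split=> [i|i k].
  have szf (f : nat -> seq nat) p (s : seq nat) : (forall j, size (f j) <= p)%N ->
      (size (flatten [seq f j | j <- s]) <= size s * p)%N.
    move=> fp; elim: s => //= j s IH; rewrite size_cat mulSn leq_add //.
  have [ri ci] := sz i; have [ri' ci'] := sz' i.
  split.
    by apply: leq_trans (szf _ n' _ _) _ => [j|]; [case: (sz' j)|rewrite leq_mul2r ri orbT].
  apply: leq_trans (szf _ n _ _) _ => [j|]; first by case: (sz j).
  by rewrite mulnC leq_mul2l ci' orbT.
have [ur rA] := h0 i; rewrite (mxmulE _ _ ur) // => AB.
have [j [jr Aj Bj]] : exists j, [/\ j \in r0 i, A i j != 0 & B j k != 0].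
  apply: contrapT => H; move/eqP: AB; apply; rewrite big_seq big1 // => j jr.
  have [->|Aj] := eqVneq (A i j) 0; first by rewrite (bi0l mb).
  have [->|Bj] := eqVneq (B j k) 0; first by rewrite (bi0r mb).
  by case: H; exists j.
have [jri icj] := h _ _ Aj; have [kr jc] := h' _ _ Bj.
split; apply/flattenP.
  by exists (r' j) => //; apply: map_f.
by exists (c j) => //; apply: map_f.
Qed.
End Mxmul.

Lemma mxmulA (U V W UV VW X : zmodType) (m1 : U -> V -> UV) (m2 : UV -> W -> X)
    (m3 : V -> W -> VW) (m4 : U -> VW -> X) :
  biadditive m1 -> biadditive m2 -> biadditive m3 -> biadditive m4 ->
  (forall u v w, m4 u (m3 v w) = m2 (m1 u v) w) ->
  forall A B C, nnz_finite A -> nnz_finite B ->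
  mxmul m4 A (mxmul m3 B C) = mxmul m2 (mxmul m1 A B) C.
Proof.
move=> b1 b2 b3 b4 mA A B C /nnz_rows[r h] /nnz_rows[r' h'].
apply/funext => i; apply/funext => l; have [ur rA] := h i.
rewrite (mxmulE b4 _ _ ur) //.
set s := undup (flatten [seq r' j | j <- r i]).
have us : uniq s by apply: undup_uniq.
have sB j k : j \in r i -> B j k != 0 -> k \in s.
  move=> jr /(h' j).2 kr; rewrite mem_undup; apply/flattenP.
  by exists (r' j) => //; apply: map_f.
rewrite (mxmulE b2 _ _ us); last first.
  move=> k; rewrite (mxmulE b1 _ _ ur) // => AB; apply: contraNT AB => ks.
  rewrite big_seq big1 // => j jr; have [->|/sB] := eqVneq (B j k) 0.
    by rewrite (bi0r b1).
  by move=> /(_ jr) ks'; rewrite ks' in ks.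
under [RHS]eq_bigr => k _ do rewrite (mxmulE b1 _ _ ur) // (bisuml b2).
rewrite exchange_big /= big_seq [RHS]big_seq; apply: eq_bigr => j jr.
rewrite (mxmulE b3 _ _ us); last by move=> k; apply: sB.
by rewrite (bisumr b4); apply: eq_bigr => k _.
Qed.

Lemma biadditive_mul (S : pzRingType) : biadditive (@GRing.mul S).
Proof. by split=> *; rewrite ?mulrDl ?mulrDr. Qed.
Lemma biadditive_zl (V : zmodType) : biadditive (fun (z : int) (v : V) => v *~ z).
Proof. by split=> *; rewrite ?mulrzDl ?mulrzDr. Qed.
Lemma biadditive_zr (V : zmodType) : biadditive (fun (v : V) (z : int) => v *~ z).
Proof. by split=> *; rewrite ?mulrzDl ?mulrzDr. Qed.

Section MxmulZ.
Variables (U V W : zmodType) (m : U -> V -> W).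
Hypothesis mb : biadditive m.

Lemma mxmulZl A A' B i k (z : int) : nnz_finite A ->
  (forall j, A' i j = A i j *~ z) -> mxmul m A' B i k = mxmul m A B i k *~ z.
Proof.
move=> /nnz_rows[r h] A'A; have [ur rA] := h i.
rewrite !(mxmulE mb _ _ ur) // => [|j]; last first.
  by rewrite A'A => Az; apply: rA; apply: contraNneq Az => ->; rewrite mul0rz.
by rewrite (bisuml (biadditive_zr W)); apply: eq_bigr => j _; rewrite A'A biMzl.
Qed.

Lemma mxmulZr A B B' i k (z : int) : nnz_finite A ->
  (forall j, B' j k = B j k *~ z) -> mxmul m A B' i k = mxmul m A B i k *~ z.
Proof.
move=> /nnz_rows[r h] B'B; have [ur rA] := h i.
rewrite !(mxmulE mb _ _ ur) //.
by rewrite (bisuml (biadditive_zr W)); apply: eq_bigr => j _; rewrite B'B biMzr.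
Qed.

Lemma mxmulZm A A' B B' i k (d : nat -> int) :
  (forall j, A' i j = A i j *~ d j) -> (forall j, B' j k = B j k *~ d j) ->
  mxmul m A' B i k = mxmul m A B' i k.
Proof.
by move=> A'A B'B; apply: eq_fsbigr => j _; rewrite A'A B'B biMzl ?biMzr.
Qed.
End MxmulZ.

(* Partially defined injections; [f n = None] when n is not in dom(f) *)

Record Emb := MkEmb {
  emb_fun :> nat -> option nat;
  emb_inj : forall i j k, emb_fun i = Some k -> emb_fun j = Some k -> i = j }.

HB.instance Definition _ := gen_eqMixin Emb.
HB.instance Definition _ := gen_choiceMixin Emb.

Lemma emb_ext (f g : Emb) : f =1 g -> f = g.
Proof.
case: f g => [f fi] [g gi] /= /funext fg; case: g / fg gi => gi.
by congr MkEmb; apply: Prop_irrelevance.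
Qed.

Section EmbMonoid.
Variables f g : Emb.

Lemma emb_comp_subproof i j k :
  obind f (g i) = Some k -> obind f (g j) = Some k -> i = j.
Proof.
case gi: (g i) => [x|] //=; case gj: (g j) => [y|] //= fx fy.
by apply: (emb_inj gi); rewrite gj (emb_inj fx fy).
Qed.
Definition emb_comp := MkEmb emb_comp_subproof.

Definition emb_dag_fun (n : nat) : option nat :=
  if pselect (exists m, f m = Some n) is left e then Some (sval (cid e)) else None.

Lemma emb_dag_funP m n : emb_dag_fun n = Some m <-> f m = Some n.
Proof.
rewrite /emb_dag_fun; case: pselect => [e|ne]; last first.
  by split=> // fm; case: ne; exists m.
by case: cid => k /= fk; split=> [[<-] //|fm]; rewrite (emb_inj fk fm).
Qed.
Lemma emb_dag_subproof i j k :
  emb_dag_fun i = Some k -> emb_dag_fun j = Some k -> i = j.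
Proof. by move=> /emb_dag_funP fi /emb_dag_funP; rewrite fi => -[]. Qed.

Definition emb_dag := MkEmb emb_dag_subproof.
End EmbMonoid.

Lemma emb_dagP (f : Emb) m n : emb_dag f n = Some m <-> f m = Some n.
Proof. exact: emb_dag_funP. Qed.

Lemma emb_id_subproof (X : set nat) i j k :
  (if i \in X then Some i else None) = Some k ->
  (if j \in X then Some j else None) = Some k -> i = j.
Proof. by case: ifP => // _ [->]; case: ifP => // _ []. Qed.

Definition emb_id (X : set nat) := MkEmb (@emb_id_subproof X).

Lemma emb_dag_id X n : emb_dag (emb_id X) n = if n \in X then Some n else None.
Proof.
case: ifP => nX; first by apply/emb_dagP; rewrite /= nX.
case e : (emb_dag _ n) => [m|] //; move/emb_dagP: e => /=; case: ifP => // mX [mn].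
by rewrite -mn mX in nX.
Qed.

Definition push (V : zmodType) (f : Emb) (a : nat -> V) : nat -> V :=
  fun n => if emb_dag f n is Some m then a m else 0.

Lemma push_id (V : zmodType) X (a : nat -> V) n :
  push (emb_id X) a n = if n \in X then a n else 0.
Proof. by rewrite /push emb_dag_id; case: ifP. Qed.

Lemma push_some (V : zmodType) (f : Emb) (a : nat -> V) m n :
  f m = Some n -> push f a n = a m.
Proof. by move=> /emb_dagP fm; rewrite /push fm. Qed.

Lemma push_comp (V : zmodType) f g (a : nat -> V) :
  push (emb_comp f g) a = push f (push g a).
Proof.
apply/funext => n; rewrite {2}/push; case fn : (emb_dag f n) => [m|].
  move/emb_dagP: fn => fm; rewrite /push; case gm : (emb_dag g m) => [k|].
    by move/emb_dagP: gm => gk; rewrite (_ : emb_dag _ n = Some k) //;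
      apply/emb_dagP; rewrite /= gk.
  case e : (emb_dag _ n) => [k|] //; move/emb_dagP: e => /=.
  case gk : (g k) => [m'|] //= fm'; rewrite (emb_inj fm' fm) in gk.
  by move/emb_dagP: gk; rewrite gm.
rewrite /push; case e : (emb_dag _ n) => [k|] //; move/emb_dagP: e => /=.
by case gk : (g k) => [m'|] //= /emb_dagP; rewrite fn.
Qed.

Lemma push0 (V : zmodType) f : push f (0 : nat -> V) = 0.
Proof. by apply/funext => n; rewrite /push; case: (emb_dag f n). Qed.

Lemma pushD (V : zmodType) f (a b : nat -> V) :
  push f (a + b) = push f a + push f b.
Proof.
by apply/funext => n; rewrite !fctE /push; case: (emb_dag f n) => [m|]; rewrite ?addr0.
Qed.

(* Decomposition of a row- and column-finite matrix along partial injections: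
   a greedy proper edge colouring of the support. *)

Section Decomposition.
Variables (V : zmodType) (A : nat -> nat -> V).
Variables (N : nat) (r c : nat -> seq nat).
Hypothesis szrc : forall i, (size (r i) <= N /\ size (c i) <= N)%N.
Hypothesis suppA : forall i j, A i j != 0 -> j \in r i /\ i \in c j.

Let mex (s : seq nat) : nat := head 0%N [seq k <- iota 0 (size s).+1 | k \notin s].

Let mexP s : mex s \notin s /\ (mex s <= size s)%N.
Proof.
rewrite /mex; case e : [seq _ <- _ | _] => [|x t] /=.
  have : {subset iota 0 (size s).+1 <= s}.
    move=> k ki; apply: contraT => ks.
    have : k \in [seq k <- iota 0 (size s).+1 | k \notin s] by rewrite mem_filter ks.
    by rewrite e.
  by move/(uniq_leq_size (iota_uniq _ _)); rewrite size_iota ltnn.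
have : x \in [seq k <- iota 0 (size s).+1 | k \notin s] by rewrite e inE eqxx.
by rewrite mem_filter mem_iota add0n ltnS => /andP[].
Qed.

Let code (i j : nat) : nat := choice.pickle (i, j).
Let nbr (n : nat) : seq nat :=
  if choice.unpickle n is Some (i, j)
  then [seq code i j' | j' <- r i] ++ [seq code i' j | i' <- c j] else [::].

Let nbr_code i j :
  nbr (code i j) = [seq code i j' | j' <- r i] ++ [seq code i' j | i' <- c j].
Proof. by rewrite /nbr /code choice.pickleK. Qed.

Fixpoint greedy_col (n : nat) : nat -> nat :=
  if n is n'.+1 then
    fun m => if m == n' then mex [seq greedy_col n' k | k <- nbr n' & (k < n')%N]
             else greedy_col n' m
  else fun=> 0%N.

Let col m := greedy_col m.+1 m.

Let greedy_stable n m : (m < n)%N -> greedy_col n m = col m.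
Proof.
elim: n => // n IH; rewrite ltnS leq_eqVlt => /orP[/eqP -> //|mn].
by rewrite /= ltn_eqF // IH.
Qed.

Let colE m : col m = mex [seq col k | k <- nbr m & (k < m)%N].
Proof.
rewrite {1}/col /= eqxx; congr mex; apply/eq_in_map => k.
by rewrite mem_filter => /andP[km _]; apply: greedy_stable.
Qed.

Let col_lt i j : (col (code i j) < (N + N).+1)%N.
Proof.
rewrite ltnS colE; apply: leq_trans (mexP _).2 _.
rewrite size_map size_filter; apply: leq_trans (count_size _ _) _.
rewrite nbr_code size_cat !size_map leq_add //.
  by case: (szrc i).
by case: (szrc j).
Qed.

Let col_neq m n : m \in nbr n -> (m < n)%N -> col m != col n.
Proof.
move=> mn ltmn; apply: contraNneq (mexP [seq col k | k <- nbr n & (k < n)%N]).1.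
by rewrite -colE => <-; apply: map_f; rewrite mem_filter ltmn.
Qed.

Let col_inj m n : m \in nbr n -> n \in nbr m -> col m = col n -> m = n.
Proof.
move=> mn nm cmn; case: (ltngtP m n) => // [/(col_neq mn)|/(col_neq nm)];
  by rewrite cmn eqxx.
Qed.

Let code_inj i j i' j' : code i j = code i' j' -> (i, j) = (i', j').
Proof. exact: (pcan_inj (@choice.pickleK _)). Qed.

Let col_row i j j' : A i j != 0 -> A i j' != 0 ->
  col (code i j) = col (code i j') -> j = j'.
Proof.
move=> /suppA[ji _] /suppA[j'i _] /col_inj e.
suff /code_inj[] : code i j = code i j' by [].
by apply: e; rewrite nbr_code mem_cat map_f.
Qed.

Let col_col i i' j : A i j != 0 -> A i' j != 0 ->
  col (code i j) = col (code i' j) -> i = i'.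
Proof.
move=> /suppA[_ ji] /suppA[_ j'i] /col_inj e.
suff /code_inj[] : code i j = code i' j by [].
by apply: e; rewrite nbr_code mem_cat orbC [_ \in map _ (c j)](map_f (code^~ j)).
Qed.

Let colour_fun k j := ohead [seq i <- c j | (A i j != 0) && (col (code i j) == k)].

Let colour_funP k i j :
  colour_fun k j = Some i <-> A i j != 0 /\ col (code i j) = k.
Proof.
rewrite /colour_fun; case e : [seq _ <- _ | _] => [|x t] /=; split => //.
- move=> [Aij cij]; suff : i \in [::] by [].
  by rewrite -e mem_filter Aij cij eqxx /=; case: (suppA Aij).
- move=> [<-]; have : x \in x :: t by rewrite inE eqxx.
  by rewrite -e mem_filter => /andP[/andP[-> /eqP ->]].
- move=> [Aij cij]; have : x \in x :: t by rewrite inE eqxx.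
  rewrite -e mem_filter => /andP[/andP[Axj /eqP cxj] _].
  by congr Some; apply: (col_col Axj Aij); rewrite cxj cij.
Qed.

Let colour_inj k i j l :
  colour_fun k i = Some l -> colour_fun k j = Some l -> i = j.
Proof.
by move=> /colour_funP[Ai ci] /colour_funP[Aj cj]; apply: (col_row Ai Aj); rewrite ci.
Qed.

Lemma nnz_decomp_aux : exists n (f : nat -> Emb),
  (forall k i j, f k j = Some i -> A i j != 0) /\
  (forall i j, A i j != 0 -> exists2 k0, (k0 < n)%N & forall k, (f k j == Some i) = (k == k0)).
Proof.
exists (N + N).+1, (fun k => MkEmb (@colour_inj k)); split=> [k i j|i j Aij].
  by move=> /colour_funP[].
exists (col (code i j)) => // k /=; apply/eqP/eqP => [/colour_funP[_ -> //]|->].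
exact/colour_funP.
Qed.
End Decomposition.

Lemma nnz_decomp (V : zmodType) (A : nat -> nat -> V) : nnz_finite A ->
  exists n (f : nat -> Emb),
    (forall k i j, f k j = Some i -> A i j != 0) /\
    forall i j, A i j = \sum_(k < n) if f k j == Some i then A i j else 0.
Proof.
move=> /nnz_finiteP[N [r [c [sz h]]]]; have [n [f [fA fk]]] := nnz_decomp_aux sz h.
exists n, f; split=> // i j; have [A0|/fk[k0 kn h0]] := eqVneq (A i j) 0.
  by rewrite A0 big1 // => k _; case: ifP.
rewrite (bigD1 (Ordinal kn)) //= h0 eqxx big1 ?addr0 // => k.
by rewrite h0 -val_eqE /= => /negPf ->.
Qed.

Lemma finite_intP T (f : T -> int) :
  finite_set (range f) <-> exists b : nat, forall x, `|f x| <= b%:Z.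
Proof.
split=> [fin|[b fb]].
  exists (\sum_(z <- fset_set (range f)) `|z|)%N => x.
  have xs : f x \in (fset_set (range f) : seq int) by rewrite in_fset_set // mem_set.
  by rewrite -abszE lez_nat (big_rem _ xs) /= leq_addr.
apply: (@sub_finite_set _ _ ((fun n : nat => n%:Z - b%:Z) @` `I_(b + b).+1)); last first.
  exact: finite_image.
move=> _ [x _ <-]; have := fb x; rewrite ler_norml => /andP[h1 h2].
have h : 0 <= f x + b%:Z by rewrite -(opprK b%:Z) subr_ge0.
exists (absz (f x + b%:Z)); last by rewrite gez0_abs // addrK.
by rewrite /= ltnS -lez_nat gez0_abs // PoszD lerD2r.
Qed.

Definition Gamma_prop (A : nat -> nat -> int) : Prop :=
  nnz_finite A /\ finite_set (range (fun ij => A ij.1 ij.2)).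

Lemma Gamma_propP A : Gamma_prop A <->
  nnz_finite A /\ exists b : nat, forall i j, `|A i j| <= b%:Z.
Proof.
split=> -[nA]; first by move=> /finite_intP[b Ab]; split=> //; exists b => i j; apply: (Ab (i, j)).
by move=> [b Ab]; split=> //; apply/finite_intP; exists b => -[i j].
Qed.

Definition Gamma_mem : {pred (nat -> nat -> int)} := fun A => `[< Gamma_prop A >].

Lemma Gamma_memP A : reflect (Gamma_prop A) (A \in Gamma_mem).
Proof. exact: asboolP. Qed.

Lemma Gamma_zmod_closed : zmod_closed Gamma_mem.
Proof.
split=> [|A B].
  by apply/Gamma_memP/Gamma_propP; split; [apply: nnz_finite0|exists 0%N].
move=> /Gamma_memP/Gamma_propP[nA [a Aa]] /Gamma_memP/Gamma_propP[nB [b Bb]].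
apply/Gamma_memP/Gamma_propP; split; first exact: nnz_finiteB.
exists (a + b)%N => i j; rewrite !fctE; apply: le_trans (ler_normB _ _) _.
by rewrite PoszD lerD.
Qed.
HB.instance Definition _ := GRing.isZmodClosed.Build _ Gamma_mem Gamma_zmod_closed.

Record Gamma := MkGamma { Gamma_val :> nat -> nat -> int; _ : Gamma_val \in Gamma_mem }.
HB.instance Definition _ := [isSub for Gamma_val].
HB.instance Definition _ := [Choice of Gamma by <:].
HB.instance Definition _ := [SubChoice_isSubZmodule of Gamma by <:].

Lemma GammaP (A : Gamma) :
  nnz_finite A /\ exists b : nat, forall i j, `|A i j| <= b%:Z.
Proof. by case: A => A /= /Gamma_memP/Gamma_propP. Qed.

Lemma Gamma_nnz (A : Gamma) : nnz_finite A.
Proof. by case: (GammaP A). Qed.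

Lemma Gamma_ext (A B : Gamma) : (forall i j, A i j = B i j) -> A = B.
Proof. by move=> AB; apply/val_inj/funext => i; apply/funext => j; apply: AB. Qed.

Lemma U_mem (f : Emb) : (fun i j => (f j == Some i)%:R : int) \in Gamma_mem.
Proof.
apply/Gamma_memP/Gamma_propP; split; last by exists 1%N => i j; case: eqP.
apply/nnz_finiteP; exists 1%N, (fun i => seq_of_opt (emb_dag f i)), (fun j => seq_of_opt (f j)).
split=> [i|i j]; first by case: (emb_dag f i); case: (f i).
have [fj _|_] := eqVneq (f j) (Some i); last by rewrite eqxx.
have /emb_dagP -> := fj; rewrite fj /=.
by rewrite !inE eqxx.
Qed.
Definition U (f : Emb) : Gamma := MkGamma (U_mem f).

Lemma Gamma_mul_mem (A B : Gamma) : mxmul *%R A B \in Gamma_mem.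
Proof.
have [nA [a Aa]] := GammaP A; have [nB [b Bb]] := GammaP B.
have bm := biadditive_mul int.
apply/Gamma_memP/Gamma_propP; split; first exact: nnz_finite_mul.
move/nnz_finiteP: (nA) => [n [r [c [sz h]]]].
exists (n * (a * b))%N => i k.
have us : uniq (undup (r i)) by apply: undup_uniq.
rewrite (mxmulE bm _ _ us) => [|j /h[]]; last by rewrite mem_undup.
apply: le_trans (ler_norm_sum _ _ _) _.
apply: (@le_trans _ _ (\sum_(j <- undup (r i)) (a * b)%N%:Z)).
  by apply: ler_sum => j _; rewrite normrM PoszM ler_pM.
rewrite big_const_seq count_predT iter_addr_0 -[_ *+ _]mulr_natl natz -PoszM lez_nat.
rewrite leq_mul2r (leq_trans (size_undup _)) ?orbT //.
by case: (sz i).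
Qed.
Definition Gamma_mul (A B : Gamma) : Gamma := MkGamma (Gamma_mul_mem A B).

Definition Gamma_one : Gamma := U (emb_id setT).
Lemma Gamma_oneE i j : Gamma_one i j = (j == i)%:R.
Proof. by rewrite /= in_setT; congr (_%:R); apply/eqP/eqP => [[]|->]. Qed.

Lemma Gamma_mulA : associative Gamma_mul.
Proof.
move=> A B C; apply: val_inj; have b := biadditive_mul int.
by apply: (mxmulA b b b b) => [u v w||]; [rewrite mulrA|apply: Gamma_nnz..].
Qed.
Lemma Gamma_mul1 : left_id Gamma_one Gamma_mul.
Proof.
move=> A; apply: Gamma_ext => i k; have b := biadditive_mul int.
change (mxmul *%R Gamma_one A i k = A i k).
rewrite (@mxmulE _ _ _ _ b _ _ [:: i]) // => [|j].
  by rewrite big_seq1 Gamma_oneE eqxx mul1r.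
by rewrite Gamma_oneE inE; case: (j == i); rewrite ?eqxx.
Qed.
Lemma Gamma_mulr1 : right_id Gamma_one Gamma_mul.
Proof.
move=> A; apply: Gamma_ext => i k; have b := biadditive_mul int.
have [r h] := nnz_rows (Gamma_nnz A).
have us : uniq (undup (k :: r i)) by apply: undup_uniq.
change (mxmul *%R A Gamma_one i k = A i k).
rewrite (mxmulE b _ _ us) => [|j /(h i).2 jr]; last by rewrite mem_undup inE jr orbT.
rewrite (bigD1_seq k) ?mem_undup ?inE ?eqxx // big1.
  by rewrite Gamma_oneE eqxx mulr1 /= addr0.
by move=> j jk; rewrite Gamma_oneE eq_sym (negPf jk) mulr0.
Qed.
Lemma Gamma_mulDl : left_distributive Gamma_mul +%R.
Proof.
move=> A B C; apply: val_inj.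
by apply: (mxmulDl (biadditive_mul int)); apply: Gamma_nnz.
Qed.
Lemma Gamma_mulDr : right_distributive Gamma_mul +%R.
Proof.
move=> A B C; apply: val_inj.
by apply: (mxmulDr (biadditive_mul int)); apply: Gamma_nnz.
Qed.
Lemma Gamma_one_neq0 : Gamma_one != 0.
Proof. by apply/eqP => /(congr1 (fun A : Gamma => A 0 0)); rewrite Gamma_oneE. Qed.

HB.instance Definition _ := GRing.Zmodule_isNzRing.Build Gamma
  Gamma_mulA Gamma_mul1 Gamma_mulr1 Gamma_mulDl Gamma_mulDr Gamma_one_neq0.

Lemma Gamma_mulE (A B : Gamma) : (A * B : Gamma) = mxmul *%R A B :> (nat -> nat -> int).
Proof. by []. Qed.

Lemma U_val (f : Emb) i j : U f i j = (f j == Some i)%:R.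
Proof. by []. Qed.

Lemma U_mul f g : U f * U g = U (emb_comp f g).
Proof.
apply: Gamma_ext => i k; have b := biadditive_mul int; rewrite Gamma_mulE U_val.
change (emb_comp f g k) with (obind f (g k)).
case fi : (emb_dag f i) => [j|]; last first.
  have fN j : (f j == Some i) = false by apply/eqP => /emb_dagP; rewrite fi.
  rewrite (@mxmulE _ _ _ _ b _ _ [::]) // => [|j]; last by rewrite U_val fN eqxx.
  by rewrite big_nil; case: (g k) => //= j; rewrite fN.
have fj j' : (f j' == Some i) = (j' == j).
  apply/eqP/eqP => [|->]; last exact/emb_dagP.
  by move/emb_dagP; rewrite fi => -[].
rewrite (@mxmulE _ _ _ _ b _ _ [:: j]) // => [|j'].
  by rewrite big_seq1 !U_val fj eqxx mul1r; case: (g k) => //= j'; rewrite fj.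
by rewrite U_val fj inE; case: (j' == j); rewrite ?eqxx.
Qed.

Lemma Gamma_valD (A B : Gamma) i j : (A + B) i j = A i j + B i j.
Proof. by []. Qed.

Lemma Gamma_valMz (A : Gamma) z i j : (A *~ z) i j = A i j *~ z.
Proof.
have h n : (A *+ n) i j = A i j *+ n.
  by elim: n => [|n IH]; rewrite ?mulr0n // !mulrS Gamma_valD IH.
by case: z => n; rewrite ?NegzE ?mulrNz -?pmulrn -?h.
Qed.

Lemma Gamma_val_sum I (s : seq I) (F : I -> Gamma) i j :
  (\sum_(k <- s) F k) i j = \sum_(k <- s) F k i j.
Proof. by elim: s => [|k s IH]; rewrite ?big_nil // !big_cons Gamma_valD IH. Qed.

Lemma Gamma_span (A : Gamma) : zspan (range U) A.
Proof.
have [nA [b Ab]] := GammaP A; have [n [f [fA Af]]] := nnz_decomp nA.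
pose s := [seq (k%:Z - b%:Z) | k <- iota 0 (b + b).+1].
pose X k v : set nat := [set j | exists2 i, f k j = Some i & A i j = v].
suff -> : A = \sum_(k < n) \sum_(v <- s) U (emb_comp (f k) (emb_id (X k v))) *~ v.
  apply: zspan_sum => k; apply: zspan_sum => v.
  exists [:: (v, U (emb_comp (f k) (emb_id (X k v))))]; last by rewrite big_seq1.
  by move=> y; rewrite inE => /eqP -> /=; exists (emb_comp (f k) (emb_id (X k v))).
apply: Gamma_ext => i j; rewrite Gamma_val_sum {1}Af; apply: eq_bigr => k _.
rewrite Gamma_val_sum; under eq_bigr => v _ do rewrite Gamma_valMz /=.
case: eqP => [fk|fk]; last first.
  rewrite big1 // => v _; case: ifP => _ /=; last by rewrite mul0rz.
  by case: eqP => //; rewrite mul0rz.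
have us : uniq s.
  rewrite map_inj_uniq ?iota_uniq // => x y /eqP.
  by rewrite (inj_eq (addIr _)) => /eqP[].
have Xj v : (j \in X k v) = (v == A i j).
  apply/idP/eqP; first by rewrite inE => -[i']; rewrite fk => -[<-] ->.
  by move=> ->; rewrite inE; exists i.
have As : A i j \in s.
  have := Ab i j; rewrite ler_norml => /andP[h1 h2].
  have h : 0 <= A i j + b%:Z by rewrite -(opprK b%:Z) subr_ge0.
  apply/mapP; exists (absz (A i j + b%:Z)); last by rewrite gez0_abs // addrK.
  by rewrite mem_iota add0n /= ltnS -lez_nat gez0_abs // PoszD lerD2r.
rewrite (bigD1_seq (A i j)) //= big1 => [|v vA].
  by rewrite Xj eqxx /= fk eqxx addr0 /= intz.
by rewrite Xj (negPf vA) /= mul0rz.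
Qed.

Definition Pspan : {pred Gamma} :=
  fun x => `[< zspan (range (fun X : set nat => U (emb_id X))) x >].

Lemma PspanP x :
  reflect (zspan (range (fun X : set nat => U (emb_id X))) x) (x \in Pspan).
Proof. exact: asboolP. Qed.

Lemma emb_id_comp X Y : emb_comp (emb_id X) (emb_id Y) = emb_id (X `&` Y).
Proof. by apply: emb_ext => n /=; rewrite in_setI andbC; case: (n \in Y). Qed.

Lemma Pspan_subring : subring_closed Pspan.
Proof.
split=> [|x y /PspanP xP /PspanP yP|x y /PspanP xP /PspanP yP]; apply/PspanP.
- by apply: zspan_gen; exists setT.
- by apply: zspanD => //; apply: zspanN.
- move: x xP; apply: zspan_ind => [|x x' hx hx'|_ [X _ <-]].
  + by rewrite mul0r; apply: zspan0.
  + by rewrite mulrBl; apply: zspanD => //; apply: zspanN.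
  move: y yP; apply: zspan_ind => [|y y' hy hy'|_ [Y _ <-]].
  + by rewrite mulr0; apply: zspan0.
  + by rewrite mulrBr; apply: zspanD => //; apply: zspanN.
  by rewrite U_mul emb_id_comp; apply: zspan_gen; exists (X `&` Y).
Qed.
HB.instance Definition _ := GRing.isSubringClosed.Build _ Pspan Pspan_subring.

Record Pring := MkP { P_val :> Gamma; _ : P_val \in Pspan }.
HB.instance Definition _ := [isSub for P_val].
HB.instance Definition _ := [Choice of Pring by <:].
HB.instance Definition _ := [SubChoice_isSubNzRing of Pring by <:].

Lemma Up_mem X : U (emb_id X) \in Pspan.
Proof. by apply/PspanP/zspan_gen; exists X. Qed.
Definition Up (X : set nat) : Pring := MkP (Up_mem X).

Lemma P_ind (Q : Pring -> Prop) :
  Q 0 -> (forall x y, Q x -> Q y -> Q (x - y)) -> (forall X, Q (Up X)) ->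
  forall p, Q p.
Proof.
move=> Q0 QB QU [p pP]; move/PspanP: (pP) => h.
suff [q qp Qq] : exists2 q : Pring, P_val q = p & Q q.
  by rewrite (_ : MkP pP = q) //; apply: val_inj; rewrite /= qp.
move: p h {pP}; apply: zspan_ind.
- by exists 0.
- by move=> _ _ [x <- Qx] [y <- Qy]; exists (x - y) => //; apply: QB.
- by move=> _ [X _ <-]; exists (Up X).
Qed.

Lemma P_diag (p : Pring) i j : i != j -> P_val p i j = 0.
Proof.
move=> ij; elim/P_ind: p => [//|x y hx hy|X].
  by rewrite /= -[RHS]subr0 -{1}hx -hy.
by rewrite /=; case: ifP => // _; case: eqP => // -[ji]; rewrite ji eqxx in ij.
Qed.

Lemma P_mul_diag (p : Pring) (A : Gamma) i j : (P_val p * A) i j = P_val p i i * A i j.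
Proof.
rewrite Gamma_mulE (@mxmulE _ _ _ _ (biadditive_mul int) _ _ [:: i]) ?big_seq1 // => k.
by apply: contraR; rewrite inE => ki; rewrite P_diag // eq_sym.
Qed.

Lemma mul_P_diag (p : Pring) (A : Gamma) i j : (A * P_val p) i j = A i j * P_val p j j.
Proof.
have [r h] := nnz_rows (Gamma_nnz A).
have us : uniq (undup (j :: r i)) by apply: undup_uniq.
rewrite Gamma_mulE (mxmulE (biadditive_mul int) _ _ us); last first.
  by move=> k /(h i).2 kr; rewrite mem_undup inE kr orbT.
rewrite (bigD1_seq j) ?mem_undup ?inE ?eqxx //= big1 ?addr0 // => k kj.
by rewrite P_diag ?mulr0.
Qed.

Lemma P_diagM (p q : Pring) i : P_val (p * q) i i = P_val p i i * P_val q i i.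
Proof. exact: P_mul_diag. Qed.

(* Tensor product of a right module M and a left module N over P: formal sums
   of pairs modulo the congruence generated by biadditivity and balancing. *)

Section Tensor.
Local Open Scope quotient_scope.
Variables (M N : zmodType) (P : Type) (ra : M -> P -> M) (la : P -> N -> N).

Inductive teq : seq (M * N) -> seq (M * N) -> Prop :=
| teq_refl s : teq s s
| teq_sym s t : teq s t -> teq t s
| teq_trans s t u : teq s t -> teq t u -> teq s u
| teq_cat s s' t t' : teq s s' -> teq t t' -> teq (s ++ t) (s' ++ t')
| teq_comm s t : teq (s ++ t) (t ++ s)
| teq_zero n : teq [:: (0, n)] [::]
| teq_addl m m' n : teq [:: (m + m', n)] [:: (m, n); (m', n)]
| teq_addr m n n' : teq [:: (m, n + n')] [:: (m, n); (m, n')]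
| teq_bal m p n : teq [:: (ra m p, n)] [:: (m, la p n)].

Definition teqb : rel (seq (M * N)) := fun s t => `[< teq s t >].

Lemma teqb_equiv : equiv_class_of teqb.
Proof.
split=> [s|s t|t s u]; first exact/asboolP/teq_refl.
  by apply/asboolP/asboolP; apply: teq_sym.
by move=> /asboolP st /asboolP tu; apply/asboolP; apply: teq_trans st tu.
Qed.
Canonical teqb_equiv_rel := EquivRelPack teqb_equiv.

Definition tensor : Type := {eq_quot teqb}.
HB.instance Definition _ := Choice.on tensor.

Definition tensor_pi (s : seq (M * N)) : tensor := \pi_({eq_quot teqb}) s.
Definition tensor_repr (x : tensor) : seq (M * N) := repr (x : {eq_quot teqb}).

Lemma tensor_reprK x : tensor_pi (tensor_repr x) = x.
Proof. exact: reprK. Qed.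

Lemma tensor_piP s t : teq s t -> tensor_pi s = tensor_pi t.
Proof. by move=> st; apply/eqmodP/asboolP. Qed.

Lemma tensor_piK s : teq (tensor_repr (tensor_pi s)) s.
Proof.
have /eqmodP/asboolP // : \pi_({eq_quot teqb}) (tensor_repr (tensor_pi s)) =
  \pi_({eq_quot teqb}) s.
exact: reprK.
Qed.

Definition tensor_add (x y : tensor) : tensor :=
  tensor_pi (tensor_repr x ++ tensor_repr y).
Definition tensor_opp (x : tensor) : tensor :=
  tensor_pi [seq (- z.1, z.2) | z <- tensor_repr x].

Lemma tensor_pi_cat s t : tensor_pi (s ++ t) = tensor_add (tensor_pi s) (tensor_pi t).
Proof. by apply/tensor_piP/teq_sym/teq_cat; apply: tensor_piK. Qed.

Lemma tensor_addC : commutative tensor_add.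
Proof. by move=> x y; apply/tensor_piP/teq_comm. Qed.
Lemma tensor_addA : associative tensor_add.
Proof.
move=> x y z; rewrite -(tensor_reprK x) -(tensor_reprK y) -(tensor_reprK z).
by rewrite -!tensor_pi_cat catA.
Qed.
Lemma tensor_add0 : left_id (tensor_pi [::]) tensor_add.
Proof. by move=> x; rewrite -{1}(tensor_reprK x) -tensor_pi_cat tensor_reprK. Qed.

Lemma teq_oppK s : teq ([seq (- z.1, z.2) | z <- s] ++ s) [::].
Proof.
elim: s => [|[m n] s IH]; first exact: teq_refl.
rewrite /= -cat1s -[(m, n) :: s]cat1s.
apply: (@teq_trans _ ([:: (- m, n)] ++ ([:: (m, n)] ++ ([seq (- z.1, z.2) | z <- s] ++ s)))).
  apply: teq_cat; first exact: teq_refl.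
  rewrite !catA; apply: teq_cat; last exact: teq_refl.
  exact: teq_comm.
rewrite catA -[[::]]/([::] ++ [::]); apply: teq_cat => //.
apply: (@teq_trans _ [:: (- m + m, n)]); first exact/teq_sym/teq_addl.
by rewrite addNr; apply: teq_zero.
Qed.

Lemma tensor_addN : left_inverse (tensor_pi [::]) tensor_opp tensor_add.
Proof.
move=> x; rewrite -{2}(tensor_reprK x) -tensor_pi_cat.
exact/tensor_piP/teq_oppK.
Qed.

HB.instance Definition _ := GRing.isZmodule.Build tensor
  tensor_addA tensor_addC tensor_add0 tensor_addN.

Definition tens (m : M) (n : N) : tensor := tensor_pi [:: (m, n)].

Lemma tens_biadditive : biadditive tens.
Proof.
split=> [m m' n|m n n'].
  by rewrite /tens (tensor_piP (teq_addl _ _ _)) -cat1s tensor_pi_cat.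
by rewrite /tens (tensor_piP (teq_addr _ _ _)) -cat1s tensor_pi_cat.
Qed.

Lemma tens_bal m p n : tens (ra m p) n = tens m (la p n).
Proof. exact/tensor_piP/teq_bal. Qed.

Lemma tensor_ind (Q : tensor -> Prop) :
  Q 0 -> (forall x y, Q x -> Q y -> Q (x + y)) -> (forall m n, Q (tens m n)) ->
  forall x, Q x.
Proof.
move=> Q0 QD Qt x; rewrite -(tensor_reprK x); elim: (tensor_repr x) => [//|[m n] s IH].
by rewrite -cat1s tensor_pi_cat; apply: QD => //; apply: Qt.
Qed.

Definition balanced (G : zmodType) (b : M -> N -> G) : Prop :=
  biadditive b /\ forall m p n, b (ra m p) n = b m (la p n).

Definition tensor_lift (G : zmodType) (b : M -> N -> G) (x : tensor) : G :=
  \sum_(z <- tensor_repr x) b z.1 z.2.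

Section Lift.
Variables (G : zmodType) (b : M -> N -> G).
Hypothesis bb : balanced b.

Lemma tensor_lift_pi s : tensor_lift b (tensor_pi s) = \sum_(z <- s) b z.1 z.2.
Proof.
have teqE u v : teq u v -> \sum_(z <- u) b z.1 z.2 = \sum_(z <- v) b z.1 z.2.
  have [bi bal] := bb.
  elim=> {u v} [//|s1 t1 _ ->//|s1 t1 u _ -> _ ->//|||n|m m' n|m n n'|m p n].
  - by move=> s1 s1' t1 t1' _ e _ e'; rewrite !big_cat e e'.
  - by move=> s1 t1; rewrite !big_cat /= addrC.
  - by rewrite big_seq1 big_nil (bi0l bi).
  - by rewrite !big_cons !big_nil !addr0 bi.1.
  - by rewrite !big_cons !big_nil !addr0 bi.2.
  - by rewrite !big_seq1 bal.
exact/teqE/tensor_piK.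
Qed.

Lemma tensor_lift_tens m n : tensor_lift b (tens m n) = b m n.
Proof. by rewrite tensor_lift_pi big_seq1. Qed.
Lemma tensor_lift0 : tensor_lift b 0 = 0.
Proof. by rewrite tensor_lift_pi big_nil. Qed.
Lemma tensor_liftD x y : tensor_lift b (x + y) = tensor_lift b x + tensor_lift b y.
Proof. by rewrite tensor_lift_pi big_cat. Qed.
End Lift.
End Tensor.

(* P-algebras: not necessarily unital rings which are P-bimodules *)

Record palgebra := PAlgebra {
  pa_sort :> zmodType;
  pa_mul : pa_sort -> pa_sort -> pa_sort;
  pa_lact : Pring -> pa_sort -> pa_sort;
  pa_ract : pa_sort -> Pring -> pa_sort;
  pa_mulA : associative pa_mul;
  pa_mul_biadd : biadditive pa_mul;
  pa_lact_biadd : biadditive pa_lact;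
  pa_lact1 : forall a, pa_lact 1 a = a;
  pa_lactM : forall p q a, pa_lact (p * q) a = pa_lact p (pa_lact q a);
  pa_ract_biadd : biadditive pa_ract;
  pa_ract1 : forall a, pa_ract a 1 = a;
  pa_ractM : forall p q a, pa_ract a (p * q) = pa_ract (pa_ract a p) q;
  pa_bimod : forall p q a, pa_ract (pa_lact p a) q = pa_lact p (pa_ract a q);
  pa_mul_lact : forall p a b, pa_mul (pa_lact p a) b = pa_lact p (pa_mul a b);
  pa_mul_ract : forall p a b, pa_mul a (pa_ract b p) = pa_ract (pa_mul a b) p;
  pa_mul_mid : forall p a b, pa_mul (pa_ract a p) b = pa_mul a (pa_lact p b) }.

Record palg_hom (A B : palgebra) := PAlgHom {
  ph_fun :> A -> B;
  ph_add : forall x y, ph_fun (x + y) = ph_fun x + ph_fun y;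
  ph_mul : forall x y, ph_fun (pa_mul x y) = pa_mul (ph_fun x) (ph_fun y);
  ph_lact : forall p x, ph_fun (pa_lact p x) = pa_lact p (ph_fun x);
  ph_ract : forall p x, ph_fun (pa_ract x p) = pa_ract (ph_fun x) p }.

(* Complete convex bornological vector spaces and algebras over C = R[i].
   The vector space is the union of the images of the injections [bincl D]. *)

Record bornVect (R : realType) := BornVect {
  bv_sort :> lmodType R[i];
  disk : Type;
  disk_le : disk -> disk -> Prop;
  bspace : disk -> completeNormedModType R[i];
  bincl : forall D, {linear bspace D -> bv_sort};
  bincl_inj : forall D, injective (bincl D);
  disk_le_refl : forall D, disk_le D D;
  disk_le_trans : forall D1 D2 D3, disk_le D1 D2 -> disk_le D2 D3 -> disk_le D1 D3;
  disk_le_bounded : forall D1 D2, disk_le D1 D2 ->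
    exists M : R[i], forall x : bspace D1,
      exists2 y : bspace D2, bincl D2 y = bincl D1 x & `|y| <= M * `|x|;
  disk_filtering : forall D1 D2, exists D3, disk_le D1 D3 /\ disk_le D2 D3;
  bv_union : forall v : bv_sort, exists D, exists x : bspace D, bincl D x = v }.

Definition born_bounded (R : realType) (V : bornVect R) (B : set V) : Prop :=
  exists (D : disk V) (M : R[i]), forall v, B v ->
    exists2 x : bspace D, bincl D x = v & `|x| <= M.

Record bornAlg (R : realType) := BornAlg {
  ba_vect :> bornVect R;
  bmul : ba_vect -> ba_vect -> ba_vect;
  bmulA : associative bmul;
  bmul_biadd : biadditive bmul;
  bmulZl : forall (c : R[i]) x y, bmul (c *: x) y = c *: bmul x y;
  bmulZr : forall (c : R[i]) x y, bmul x (c *: y) = c *: bmul x y;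
  bmul_bounded : forall B1 B2 : set ba_vect, born_bounded B1 -> born_bounded B2 ->
    born_bounded [set bmul x y | x in B1 & y in B2] }.

Section SymIdeal.
Variable R : realType.
Local Notation C := R[i].

Definition bounded_seq (x : nat -> C) : Prop := exists M : C, forall n, `|x n| <= M.

Record symIdeal := SymIdeal {
  si_set :> (nat -> C) -> Prop;
  si_bounded : forall x, si_set x -> bounded_seq x;
  si_0 : si_set (fun=> 0);
  si_D : forall x y, si_set x -> si_set y -> si_set (fun n => x n + y n);
  si_M : forall a x, bounded_seq a -> si_set x -> si_set (fun n => a n * x n);
  si_push : forall f x, si_set x -> si_set (push f x) }.

Lemma norm_le_ge0 (V : normedZmodType C) (v : V) (M : C) : `|v| <= M -> 0 <= M.
Proof. exact: le_trans. Qed.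

Lemma bounded_seqD x y : bounded_seq x -> bounded_seq y ->
  bounded_seq (fun n => x n + y n).
Proof.
move=> [M xM] [N yN]; exists (M + N) => n.
by apply: le_trans (ler_normD _ _) _; apply: lerD.
Qed.

Lemma bounded_seqM x y : bounded_seq x -> bounded_seq y ->
  bounded_seq (fun n => x n * y n).
Proof.
by move=> [M xM] [N yN]; exists (M * N) => n; rewrite normrM; apply: ler_pM.
Qed.

Lemma bounded_seq_push f x : bounded_seq x -> bounded_seq (push f x).
Proof.
move=> [M xM]; exists M => n; rewrite /push; case: (emb_dag f n) => [m|] //.
by rewrite normr0; apply: norm_le_ge0 (xM 0%N).
Qed.

Lemma bounded_seq0 : bounded_seq (fun=> 0).
Proof. by exists 0 => n; rewrite normr0. Qed.

Definition linf : symIdeal :=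
  SymIdeal (si_set := bounded_seq) (fun x h => h) bounded_seq0
    bounded_seqD bounded_seqM bounded_seq_push.

Lemma si_solid (S : symIdeal) (x y : nat -> C) : S x ->
  (forall n, `|y n| <= `|x n|) -> S y.
Proof.
move=> Sx yx; have -> : y = (fun n => (y n / x n) * x n).
  apply/funext => n; have [x0|x0] := eqVneq (x n) 0; last by rewrite divfK.
  by have := yx n; rewrite x0 normr0 normr_le0 => /eqP ->; rewrite mulr0.
apply: si_M => //; exists 1 => n; rewrite normrM normfV.
have [x0|x0] := eqVneq (x n) 0; first by rewrite x0 normr0 invr0 mulr0.
by rewrite ler_pdivrMr ?normr_gt0 // mul1r.
Qed.

(* S(X), transported along a bijection; independent of it by symmetry *)
Definition si_on (S : symIdeal) (X : Type) (x : X -> C) : Prop :=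
  exists2 e : nat -> X, bijective e & S (x \o e).

Lemma bij_push (V : zmodType) (e e' : nat -> nat) (x : nat -> V) :
  cancel e e' -> cancel e' e -> exists f, push f (x \o e) = x.
Proof.
move=> ee' e'e; have ei i j k : Some (e i) = Some k -> Some (e j) = Some k -> i = j.
  by move=> [<-] [/(can_inj ee') ->].
exists (MkEmb ei); apply/funext => n.
by rewrite (@push_some _ _ _ (e' n) n) /= ?e'e.
Qed.

Lemma si_onE (S : symIdeal) (x : nat -> C) : si_on S x <-> S x.
Proof.
split=> [[e [e' ee' e'e] Sx]|Sx]; last by exists id => //; exists id.
by have [f <-] := bij_push x ee' e'e; apply: si_push.
Qed.

Lemma si_on_linf (X : Type) (x : X -> C) : (exists e : nat -> X, bijective e) ->
  si_on linf x <-> exists M : C, forall n, `|x n| <= M.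
Proof.
move=> [e eb]; split=> [[f [f' ff' f'f] [M xM]]|[M xM]].
  by exists M => n; have := xM (f' n); rewrite /= f'f.
by exists e => //; exists M => n; apply: xM.
Qed.

Lemma nat2_bij : exists e : nat -> nat * nat, bijective e.
Proof.
have /card_esym/ppcard_eqP[f] := card_nat2.
exists f; exists (f^-1)%FUN; first by move=> n; rewrite funK // inE.
by move=> n; rewrite invK // inE.
Qed.
End SymIdeal.

(* S(X, A) *)
Definition fam (R : realType) (S : symIdeal R) (X : Type) (A : bornVect R)
    (a : X -> A) : Prop :=
  exists (D : disk A) (b : X -> bspace D),
    (forall x, bincl D (b x) = a x) /\ si_on S (fun x => `|b x|).

Section Families.
Variables (R : realType) (A : bornVect R) (S : symIdeal R).
Local Notation C := R[i].

Lemma bshare (D1 D2 : disk A) : exists D3 (M1 M2 : C),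
  (forall x : bspace D1, exists2 y : bspace D3, bincl D3 y = bincl D1 x & `|y| <= M1 * `|x|) /\
  (forall x : bspace D2, exists2 y : bspace D3, bincl D3 y = bincl D2 x & `|y| <= M2 * `|x|).
Proof.
have [D3 [/disk_le_bounded[M1 h1] /disk_le_bounded[M2 h2]]] := disk_filtering D1 D2.
by exists D3, M1, M2.
Qed.

Lemma fam_natE (a : nat -> A) : fam S a <->
  exists (D : disk A) (b : nat -> bspace D),
    (forall n, bincl D (b n) = a n) /\ S (fun n => `|b n|).
Proof. by split=> -[D [b [ba /si_onE Sb]]]; exists D, b. Qed.

Lemma bounded_seq_cst (M : C) : bounded_seq (fun=> M).
Proof. by exists `|M|. Qed.

Lemma fam_zmod_closed : zmod_closed (fun a : nat -> A => `[< fam S a >]).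
Proof.
split=> [|a a' /asboolP/fam_natE[D [b [ba Sb]]] /asboolP/fam_natE[D' [b' [ba' Sb']]]].
  apply/asboolP/fam_natE; have [D _] := bv_union (0 : A).
  exists D, (fun=> 0); split=> [n|]; first by rewrite linear0.
  by apply: si_solid (si_0 S) _ => n; rewrite !normr0.
have [E [M1 [M2 [h1 h2]]]] := bshare D D'.
have /choice[c hc] n : exists y : bspace E, bincl E y = a n - a' n /\
    `|y| <= M1 * `|b n| + M2 * `|b' n|.
  have [y1 e1 l1] := h1 (b n); have [y2 e2 l2] := h2 (b' n).
  exists (y1 - y2); rewrite linearB e1 e2 ba ba'; split=> //.
  by apply: le_trans (ler_normB _ _) _; apply: lerD.
apply/asboolP/fam_natE; exists E, c; split=> [n|]; first by case: (hc n).
apply: (@si_solid _ _ (fun n => M1 * `|b n| + M2 * `|b' n|)) => [|n].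
  by apply: si_D; apply: si_M => //; apply: bounded_seq_cst.
have [_ h] := hc n; rewrite normr_id ger0_norm //; exact: norm_le_ge0 h.
Qed.
End Families.

Definition fam_mem (R : realType) (S : symIdeal R) (A : bornAlg R) :
  {pred (nat -> A)} := fun a => `[< fam S a >].
Arguments fam_mem {R} S A.

Section SeqS.
Variables (R : realType) (S : symIdeal R) (A : bornAlg R).
Local Notation C := R[i].

HB.instance Definition _ :=
  GRing.isZmodClosed.Build (nat -> A) (fam_mem S A) (@fam_zmod_closed R A S).

Record seqS := MkSeqS { seq_val :> nat -> A; _ : seq_val \in fam_mem S A }.
HB.instance Definition _ := [isSub for seq_val].
HB.instance Definition _ := [Choice of seqS by <:].
HB.instance Definition _ := [SubChoice_isSubZmodule of seqS by <:].

Lemma seqSP (a : seqS) : exists (D : disk A) (b : nat -> bspace D),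
    (forall n, bincl D (b n) = a n) /\ S (fun n => `|b n|).
Proof. by case: a => a /= /asboolP/fam_natE. Qed.

Lemma seqS_ext (a b : seqS) : (forall n, a n = b n) -> a = b.
Proof. by move=> ab; apply/val_inj/funext. Qed.

Lemma seq_valD (a b : seqS) n : (a + b) n = a n + b n.
Proof. by []. Qed.
Lemma seq_valN (a : seqS) n : (- a) n = - a n.
Proof. by []. Qed.
Lemma seq_val0 n : (0 : seqS) n = 0.
Proof. by []. Qed.
Lemma seq_valMz (a : seqS) z n : (a *~ z) n = a n *~ z.
Proof.
have h k : (a *+ k) n = a n *+ k.
  by elim: k => [|k IH]; rewrite ?mulr0n // !mulrS seq_valD IH.
by case: z => k; rewrite ?NegzE ?mulrNz ?seq_valN -?pmulrn -?h.
Qed.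

Lemma spush_mem f (a : seqS) : push f a \in fam_mem S A.
Proof.
have [D [b [ba Sb]]] := seqSP a; apply/asboolP/fam_natE.
exists D, (push f b); split=> [n|].
  by rewrite /push; case: (emb_dag f n) => [m|]; rewrite ?linear0.
suff -> : (fun n => `|push f b n|) = push f (fun n => `|b n|) by apply: si_push.
by apply/funext => n; rewrite /push; case: (emb_dag f n) => [m|]; rewrite ?normr0.
Qed.
Definition spush f (a : seqS) : seqS := MkSeqS (spush_mem f a).

(* The action of P on S(A): the additive extension of U_p . a = a . U_p = p_*(a),
   see [pactU]; elements of P are diagonal matrices. *)
Lemma pact_mem (a : seqS) (p : Pring) :
  (fun n => a n *~ (P_val p n n)) \in fam_mem S A.
Proof.
have [D [b [ba Sb]]] := seqSP a; apply/asboolP/fam_natE.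
exists D, (fun n => b n *~ P_val p n n); split=> [n|].
  by rewrite -ba raddfMz.
have [_ [B pB]] := GammaP (P_val p).
apply: (@si_solid _ _ (fun n => B%:R * `|b n|)) => [|n].
  by apply: si_M => //; apply: bounded_seq_cst.
rewrite normrM !normr_id normr_nat mulr_natl.
have nz (v : bspace D) (z : int) : `|v *~ z| = `|v| *+ `|z|%N.
  by case: z => k; rewrite ?NegzE ?mulrNz ?normrN -?pmulrn normrMn.
rewrite nz; apply: ler_wpMn2l; first exact: normr_ge0.
by have := pB n n; rewrite -abszE lez_nat.
Qed.
Definition pact (a : seqS) (p : Pring) : seqS := MkSeqS (pact_mem a p).

Lemma pactU X (a : seqS) : pact a (Up X) = spush (emb_id X) a.
Proof.
apply: seqS_ext => n; rewrite /= push_id.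
by case: ifP => _; rewrite ?mulr0z // eqxx mulr1z.
Qed.

Lemma pact_biadd : biadditive pact.
Proof.
by split=> [a b p|a p q]; apply: seqS_ext => n; rewrite seq_valD /= ?mulrzDl ?mulrzDr.
Qed.
Lemma pact1 a : pact a 1 = a.
Proof. by apply: seqS_ext => n; rewrite /= in_setT eqxx mulr1z. Qed.
Lemma pactM a p q : pact a (p * q) = pact (pact a p) q.
Proof. by apply: seqS_ext => n; rewrite /= -mulrzA -P_diagM. Qed.
Lemma pactC a p q : pact (pact a p) q = pact (pact a q) p.
Proof. by apply: seqS_ext => n; rewrite /= mulrzAC. Qed.

Lemma bmul_norm (D1 D2 : disk A) : exists D3 (M : C), 0 <= M /\
  forall (x : bspace D1) (y : bspace D2), exists2 z : bspace D3,
    bincl D3 z = bmul (bincl D1 x) (bincl D2 y) & `|z| <= M * `|x| * `|y|.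
Proof.
pose ball D : set A := [set bincl D x | x in [set x : bspace D | `|x| <= 1]].
have bb D : born_bounded (ball D).
  by exists D, 1 => _ [x x1 <-]; exists x.
have [D3 [M h]] := bmul_bounded (bb D1) (bb D2).
have h1 (x : bspace D1) (y : bspace D2) : `|x| <= 1 -> `|y| <= 1 ->
    exists2 z : bspace D3, bincl D3 z = bmul (bincl D1 x) (bincl D2 y) & `|z| <= M.
  move=> x1 y1; apply: h; exists (bincl D1 x); first by exists x.
  by exists (bincl D2 y) => //; exists y.
have M0 : 0 <= M.
  have [||z _ zM] := h1 0 0; rewrite ?normr0 ?ler01 //.
  exact: norm_le_ge0 zM.
exists D3, M; split=> // x y.
have [x0|x0] := eqVneq x 0.
  exists 0; last by rewrite x0 !normr0 mulr0 mul0r.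
  by rewrite x0 !linear0 (bi0l (bmul_biadd A)).
have [y0|y0] := eqVneq y 0.
  exists 0; last by rewrite y0 !normr0 mulr0.
  by rewrite y0 !linear0 (bi0r (bmul_biadd A)).
have hu (D : disk A) (v : bspace D) : v != 0 -> `|(`|v|^-1 : C) *: v| <= 1.
  by move=> v0; rewrite normrZ normfV normr_id mulVf // normr_eq0.
have [z ze zM] := h1 _ _ (hu _ _ x0) (hu _ _ y0).
exists ((`|x| * `|y|) *: z).
  rewrite linearZ /= ze !linearZ /= bmulZl bmulZr !scalerA.
  rewrite (_ : _ * _ = 1) ?scale1r //.
  by rewrite -invfM mulfV // mulf_neq0 ?normr_eq0.
rewrite normrZ normrM !normr_id -mulrA mulrC ler_wpM2r //.
by apply: mulr_ge0.
Qed.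

Lemma smul_mem (a b : seqS) : (fun n => bmul (a n) (b n)) \in fam_mem S A.
Proof.
have [D1 [x [xa Sx]]] := seqSP a; have [D2 [y [yb Sy]]] := seqSP b.
have [D3 [M [M0 h]]] := bmul_norm D1 D2.
have /choice[z hz] n : exists z : bspace D3, bincl D3 z = bmul (a n) (b n) /\
    `|z| <= M * `|x n| * `|y n|.
  by have [z ze zM] := h (x n) (y n); exists z; rewrite ze xa yb.
apply/asboolP/fam_natE; exists D3, z; split=> [n|]; first by case: (hz n).
apply: (@si_solid _ _ (fun n => (M * `|x n|) * `|y n|)) => [|n].
  apply: si_M => //; have [N xN] := si_bounded Sx; exists (M * N) => n.
  by rewrite normrM ger0_norm // ler_wpM2l.
by have [_ zM] := hz n; rewrite normr_id ger0_norm // !mulr_ge0.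
Qed.
Definition smul (a b : seqS) : seqS := MkSeqS (smul_mem a b).

Lemma smul_biadd : biadditive smul.
Proof.
by split=> [a b c|a b c]; apply: seqS_ext => n;
   rewrite seq_valD /= ?(bmul_biadd A).1 ?(bmul_biadd A).2.
Qed.

End SeqS.

Definition P_lact (p : Pring) (g : Gamma) : Gamma := P_val p * g.

Section Crossed.
Variables (R : realType) (S : symIdeal R) (A : bornAlg R).
Local Notation SA := (seqS S A).

Definition crossed_tensor : zmodType :=
  tensor (@pact R S A) P_lact.
Local Notation T := crossed_tensor.

Definition hash (a : SA) (g : Gamma) : T := tens _ _ a g.
Local Notation "a # g" := (hash a g) (at level 40).

Lemma hash_biadd : biadditive hash.
Proof. exact: tens_biadditive. Qed.
Lemma hash_bal a p g : pact a p # g = a # (P_val p * g).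
Proof. exact: tens_bal. Qed.

Lemma hash_ind (Q : T -> Prop) :
  Q 0 -> (forall x y, Q x -> Q y -> Q (x - y)) -> (forall a f, Q (a # U f)) ->
  forall x, Q x.
Proof.
move=> Q0 QB Qt; have QN y : Q y -> Q (- y) by move=> Qy; rewrite -[- y]add0r; apply: QB.
have QD x y : Q x -> Q y -> Q (x + y) by move=> Qx Qy; rewrite -[y]opprK; apply/QB/QN.
apply: tensor_ind => // a g; move: g (Gamma_span g); apply: zspan_ind.
- by rewrite (_ : tens _ _ _ _ = 0) //; apply: (bi0r hash_biadd).
- move=> x y Qx Qy; have -> : tens _ _ a (x - y) = a # x - a # y.
    by rewrite -(biNr hash_biadd) -hash_biadd.2.
  exact: QB.
- by move=> _ [f _ <-]; apply: Qt.
Qed.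

(* the matrix of a # g: its (i, j) entry is a_i g_ij *)
Definition diag_mul (a : SA) (g : Gamma) : nat -> nat -> A := fun i j => a i *~ g i j.

Lemma diag_mul_bal :
  balanced (@pact R S A) P_lact diag_mul.
Proof.
split; last first.
  move=> a p g; apply/funext => i; apply/funext => j.
  by rewrite /diag_mul P_mul_diag /= mulrzA.
by split=> [a b g|a g h]; apply/funext => i; apply/funext => j;
  rewrite /diag_mul !fctE ?mulrzDl ?mulrzDr.
Qed.

Definition mx_of : T -> nat -> nat -> A := tensor_lift diag_mul.

Lemma mx_of_hash a g i j : mx_of (a # g) i j = a i *~ g i j.
Proof. by rewrite /mx_of tensor_lift_tens //; apply: diag_mul_bal. Qed.
Lemma mx_of0 : mx_of 0 = 0.
Proof. by rewrite /mx_of tensor_lift0 //; apply: diag_mul_bal. Qed.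
Lemma mx_ofD x y : mx_of (x + y) = mx_of x + mx_of y.
Proof. by rewrite /mx_of tensor_liftD //; apply: diag_mul_bal. Qed.
Lemma mx_ofN x : mx_of (- x) = - mx_of x.
Proof. by apply: (addrI (mx_of x)); rewrite -mx_ofD !subrr mx_of0. Qed.
Lemma mx_ofB x y : mx_of (x - y) = mx_of x - mx_of y.
Proof. by rewrite mx_ofD mx_ofN. Qed.
Lemma mx_of_sum I (s : seq I) (F : I -> T) :
  mx_of (\sum_(k <- s) F k) = \sum_(k <- s) mx_of (F k).
Proof. by elim: s => [|k s IH]; rewrite ?big_nil ?mx_of0 // !big_cons mx_ofD IH. Qed.

Lemma mx_of_nnz x : nnz_finite (mx_of x).
Proof.
elim/hash_ind: x => [|x y hx hy|a f].
- by rewrite mx_of0; apply: nnz_finite0.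
- by rewrite mx_ofB; apply: nnz_finiteB.
apply: nnz_finite_sub (Gamma_nnz (U f)) => i j; rewrite mx_of_hash.
by apply: contraNneq => ->; rewrite mulr0z.
Qed.

(* Faithfulness: every element is a sum of a_k # U_(f_k) with the f_k having
   pairwise disjoint graphs. *)

Definition disjE (f g : Emb) := forall i j, f j = Some i -> g j = Some i -> False.

Fixpoint disj (s : seq (SA * Emb)) : Prop :=
  if s is y :: s' then (forall z, z \in s' -> disjE y.2 z.2) /\ disj s' else True.

Let agree (f g : Emb) : set nat := [set i | exists j, f j = Some i /\ g j = Some i].
Let res (X : set nat) (f : Emb) := emb_comp (emb_id X) f.

Let resE X f i j : (res X f j == Some i) = (i \in X) && (f j == Some i).
Proof.
rewrite /res /=; case: (f j) => [k|] /=; last by rewrite andbF.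
rewrite -[Some k == Some i]/(k == i); have [->|ki] := eqVneq k i.
  by case: (i \in X); rewrite ?eqxx.
rewrite andbF; case: ifP => // _.
by rewrite -[Some k == Some i]/(k == i) (negPf ki).
Qed.

Fixpoint ins (a : SA) (f : Emb) (s : seq (SA * Emb)) : seq (SA * Emb) :=
  if s is y :: s' then
    (y.1 + pact a (Up (agree f y.2)), y.2) :: ins a (res (~` agree f y.2) f) s'
  else [:: (a, f)].

Let val_sum (s : seq (SA * Emb)) : T := \sum_(y <- s) y.1 # U y.2.

Let pact_U a X f : pact a (Up X) # U f = a # U (res X f).
Proof. by rewrite hash_bal /= U_mul. Qed.

Lemma ins_sum a f s : val_sum (ins a f s) = a # U f + val_sum s.
Proof.
have [hl hr] := hash_biadd.
elim: s a f => [|[b g] s IH] a f; rewrite /val_sum /= !big_cons ?big_nil //=.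
rewrite -/(val_sum _) IH hl -addrA [RHS]addrCA; congr (_ + _).
rewrite addrA; congr (_ + _); rewrite pact_U.
have -> : res (agree f g) g = res (agree f g) f.
  apply: emb_ext => j; rewrite /res /=.
  case fj : (f j) => [i|]; case gj : (g j) => [k|] //=.
  - case: ifP => [|kN].
      rewrite inE => -[j' [fj' gj']]; have e := emb_inj gj' gj; rewrite e in fj'.
      by move: fj'; rewrite fj => -[ik]; rewrite ik in fj *; rewrite mem_set //; exists j.
    case: ifP => // iA; move: (iA); rewrite inE => -[j' [fj' gj']].
    by have e := emb_inj fj' fj; rewrite e gj in gj'; case: gj' => ki; rewrite ki iA in kN.
  - case: ifP => //; rewrite inE => -[j' [fj' gj']].
    by have e := emb_inj fj' fj; rewrite e gj in gj'.
  - case: ifP => //; rewrite inE => -[j' [fj' gj']].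
    by have e := emb_inj gj' gj; rewrite e fj in fj'.
rewrite -hr; congr (_ # _); apply: Gamma_ext => i j.
rewrite Gamma_valD !U_val !resE in_setC.
by case: (i \in agree f g); case: (f j == _).
Qed.

Lemma disj_sub (h f g : Emb) :
  (forall i j, g j = Some i -> f j = Some i) -> disjE h f -> disjE h g.
Proof. by move=> gf hf i j hj /gf; apply: hf. Qed.

Let res_sub X f i j : res X f j = Some i -> f j = Some i.
Proof. by move/eqP; rewrite resE => /andP[_ /eqP]. Qed.

Lemma ins_In a f s h : (forall z, z \in s -> disjE h z.2) -> disjE h f ->
  forall z, z \in ins a f s -> disjE h z.2.
Proof.
elim: s a f => [|[b g] s IH] a f hs hf z /=; first by rewrite inE => /eqP ->.
rewrite inE => /predU1P[->|]; first by apply: (hs (b, g)); apply: mem_head.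
apply: IH; first by move=> w ws; apply: hs; rewrite inE ws orbT.
by apply: disj_sub hf; apply: res_sub.
Qed.

Lemma ins_disj a f s : disj s -> disj (ins a f s).
Proof.
elim: s a f => [|[b g] s IH] a f //= [gs ds]; split; last exact: IH.
apply: ins_In => // i j gj /eqP; rewrite resE in_setC => /andP[+ /eqP fj].
by rewrite mem_set //; exists j.
Qed.

Lemma disj_form (x : T) : exists2 s, disj s & x = val_sum s.
Proof.
have [hl hr] := hash_biadd.
have form (t : seq (SA * Emb)) : exists2 s, disj s & val_sum t = val_sum s.
  elim: t => [|[a f] t [s ds e]]; first by exists [::].
  exists (ins a f s); first exact: ins_disj.
  by rewrite ins_sum -e /val_sum big_cons.
suff [t ->] : exists t, x = val_sum t by apply: form.
elim/hash_ind: x => [|_ _ [s ->] [t ->]|a f].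
- by exists [::]; rewrite /val_sum big_nil.
- exists (s ++ [seq (- y.1, y.2) | y <- t]); rewrite /val_sum big_cat big_map /=.
  congr (_ + _); rewrite -sumrN; apply: eq_bigr => y _.
  by rewrite (biNl hash_biadd).
- by exists [:: (a, f)]; rewrite /val_sum big_seq1.
Qed.

Lemma mx_of_eq0 x : mx_of x = 0 -> x = 0.
Proof.
have [s ds ->] := disj_form x; elim: s ds => [|[a f] s IH] /=.
  by rewrite /val_sum big_nil.
move=> [fs ds]; rewrite /val_sum big_cons -/(val_sum s) /= => e.
have s0 i j : f j = Some i -> mx_of (val_sum s) i j = 0.
  move=> fj; rewrite /val_sum; elim: s fs {IH ds e} => [|[b g] s IH] fs.
    by rewrite big_nil mx_of0.
  rewrite big_cons mx_ofD !fctE IH ?addr0; last by move=> z zs; apply: fs; rewrite inE zs orbT.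
  rewrite mx_of_hash /=; case: eqP => gj; rewrite ?mulr0z //.
  by case: (fs (b, g) (mem_head _ _) i j fj gj).
have a0 i j : f j = Some i -> a i = 0.
  move=> fj; have := congr1 (fun M => M i j) e; rewrite mx_ofD !fctE s0 // addr0.
  by rewrite mx_of_hash U_val fj eqxx mulr1z.
suff af : a # U f = 0.
  by rewrite af add0r; apply: IH => //; rewrite af add0r in e.
pose X : set nat := [set i | exists j, f j = Some i].
have -> : U f = U (res X f).
  congr U; apply: emb_ext => j; rewrite /res /=; case fj : (f j) => [i|] //=.
  by rewrite mem_set //; exists j.
rewrite -pact_U (_ : pact a (Up X) = 0) ?(bi0l hash_biadd) //.
apply: seqS_ext => n; rewrite pactU /= push_id; case: ifP => //.
by rewrite inE => -[j /a0].
Qed.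

Lemma mx_of_inj : injective mx_of.
Proof. by move=> x y e; apply/subr0_eq/mx_of_eq0; rewrite mx_ofB e subrr. Qed.

Lemma mx_of_ext x y : (forall i j, mx_of x i j = mx_of y i j) -> x = y.
Proof. by move=> e; apply/mx_of_inj/funext => i; apply/funext => j. Qed.

(* The twist g (x) b |-> sum_k n_k f_k*(b) # U_(f_k) for g = sum_k n_k U_(f_k);
   by [twist_mx] it does not depend on the decomposition of g. *)

Lemma emb_decomp_ex (g : Gamma) : exists s : seq (int * Emb),
  g = \sum_(y <- s) U y.2 *~ y.1.
Proof.
have [s sU ->] := Gamma_span g; elim: s sU => [|[z h] s IH] sU.
  by exists [::]; rewrite !big_nil.
have [|t e] := IH; first by move=> y ys; apply: sU; rewrite inE ys orbT.
have [f _ fh] := sU _ (mem_head _ _); exists ((z, f) :: t).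
by rewrite !big_cons e /= fh.
Qed.
Definition emb_decomp (g : Gamma) : seq (int * Emb) := sval (cid (emb_decomp_ex g)).
Lemma emb_decompE g : g = \sum_(y <- emb_decomp g) U y.2 *~ y.1.
Proof. by rewrite /emb_decomp; case: cid. Qed.

Definition twist (g : Gamma) (b : SA) : T :=
  \sum_(y <- emb_decomp g) (spush y.2 b # U y.2) *~ y.1.

Lemma mx_ofMz x z i j : mx_of (x *~ z) i j = mx_of x i j *~ z.
Proof.
have h k : mx_of (x *+ k) i j = mx_of x i j *+ k.
  by elim: k => [|k IH]; rewrite ?mulr0n ?mx_of0 // !mulrS mx_ofD !fctE IH.
by case: z => k; rewrite ?NegzE ?mulrNz ?mx_ofN ?fctE -!pmulrn h.
Qed.

Lemma mx_sum_val I (s : seq I) (F : I -> nat -> nat -> A) i j :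
  (\sum_(k <- s) F k) i j = \sum_(k <- s) F k i j.
Proof. by elim: s => [|k s IH]; rewrite ?big_nil // !big_cons !fctE IH. Qed.

Lemma twist_mx g b i j : mx_of (twist g b) i j = b j *~ g i j.
Proof.
rewrite {2}(emb_decompE g) /twist mx_of_sum mx_sum_val Gamma_val_sum.
rewrite (bisumr (biadditive_zr A)); apply: eq_bigr => y _.
rewrite mx_ofMz mx_of_hash Gamma_valMz U_val mulrzz [RHS]mulrzA; congr (_ *~ _).
by have [e|_] := eqVneq (y.2 j) (Some i); rewrite ?mulr0z //= (push_some _ e).
Qed.

Lemma twist_biadd : biadditive twist.
Proof.
by split=> [g h b|g b c]; apply: mx_of_ext => i j;
  rewrite mx_ofD !fctE !twist_mx ?Gamma_valD ?seq_valD ?mulrzDr ?mulrzDl.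
Qed.

Lemma twistU f b : twist (U f) b = spush f b # U f.
Proof.
apply: mx_of_ext => i j; rewrite twist_mx mx_of_hash U_val.
by have [e|_] := eqVneq (f j) (Some i); rewrite ?mulr0z //= (push_some _ e).
Qed.

Definition lmul (a : SA) : T -> T := tensor_lift (fun b g => smul a b # g).
Definition rmul (h : Gamma) : T -> T := tensor_lift (fun b g => b # (g * h)).

Lemma lmul_bal a : balanced (@pact R S A) P_lact
  (fun b g => smul a b # g).
Proof.
have [hl hr] := hash_biadd; split.
  by split=> *; rewrite ?(smul_biadd S A).2 ?hl ?hr.
move=> b p g; rewrite -hash_bal; congr (_ # _).
by apply: seqS_ext => n; rewrite /= (biMzr (bmul_biadd A)).
Qed.
Lemma rmul_bal h : balanced (@pact R S A) P_lact
  (fun b g => b # (g * h)).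
Proof.
have [hl hr] := hash_biadd; split; first by split=> *; rewrite ?mulrDl ?hl ?hr.
by move=> b p g; rewrite hash_bal mulrA.
Qed.

Lemma mx_of_lmul a x i j : mx_of (lmul a x) i j = bmul (a i) (mx_of x i j).
Proof.
have b0 := bi0r (bmul_biadd A); rewrite /lmul.
elim/tensor_ind: x => [|x y hx hy|b g].
- by rewrite (tensor_lift0 (lmul_bal a)) mx_of0 b0.
- by rewrite (tensor_liftD (lmul_bal a)) !mx_ofD !fctE hx hy (bmul_biadd A).2.
- rewrite (tensor_lift_tens (lmul_bal a)) -/(hash b g) !mx_of_hash /=.
  by rewrite (biMzr (bmul_biadd A)).
Qed.

Lemma mx_of_rmul h x :
  mx_of (rmul h x) = mxmul (fun (a : A) (z : int) => a *~ z) (mx_of x) h.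
Proof.
have bz := biadditive_zr A; rewrite /rmul.
elim/tensor_ind: x => [|x y hx hy|b g].
- rewrite (tensor_lift0 (rmul_bal h)) mx_of0.
  apply/funext => i; apply/funext => j.
  by rewrite (@mxmulE _ _ _ _ bz _ _ [::]) ?big_nil // => k; rewrite eqxx.
- rewrite (tensor_liftD (rmul_bal h)) !mx_ofD hx hy (mxmulDl bz) //;
  exact: mx_of_nnz.
- rewrite (tensor_lift_tens (rmul_bal h)) -/(hash b g).
  apply/funext => i; apply/funext => j; rewrite mx_of_hash.
  have [r hr] := nnz_rows (Gamma_nnz g); have [ur rg] := hr i.
  rewrite Gamma_mulE (mxmulE (biadditive_mul int) _ _ ur) //.
  rewrite (mxmulE bz _ _ ur) => [|k]; last first.
    by move=> bk; apply: rg; apply: contraNneq bk => gk; rewrite mx_of_hash gk mulr0z.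
  rewrite (bisumr bz); apply: eq_bigr => k _.
  by rewrite mx_of_hash -mulrzA.
Qed.

(* Only the values (a # U_f)(b # U_g) = a f_*(b) # U_fg matter: see [crossed_mulE]. *)

Definition crossed_mul_gen (a : SA) (g : Gamma) : T -> T :=
  tensor_lift (fun b h => lmul a (rmul h (twist g b))).

Definition crossed_mul (x y : T) : T :=
  tensor_lift (fun a g => crossed_mul_gen a g y) x.

Let mp (a : A) (z : int) : A := a *~ z.

Lemma mx_of_lrt a g b h i k :
  mx_of (lmul a (rmul h (twist g b))) i k =
  mxmul (@bmul R A) (mx_of (a # g)) (mx_of (b # h)) i k.
Proof.
rewrite mx_of_lmul mx_of_rmul.
have [r hr] := nnz_rows (Gamma_nnz g); have [ur rg] := hr i.
rewrite (mxmulE (bmul_biadd A) _ _ ur) => [|j]; last first.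
  by move=> bk; apply: rg; apply: contraNneq bk => gk; rewrite mx_of_hash gk mulr0z.
rewrite (mxmulE (biadditive_zr A) _ _ ur) => [|j]; last first.
  by move=> bk; apply: rg; apply: contraNneq bk => gk; rewrite twist_mx gk mulr0z.
rewrite (bisumr (bmul_biadd A)); apply: eq_bigr => j _.
rewrite twist_mx !mx_of_hash (biMzl (bmul_biadd A)) !(biMzr (bmul_biadd A)).
by rewrite mulrzAC.
Qed.

Lemma mxD (M N : nat -> nat -> A) i j : (M + N) i j = M i j + N i j.
Proof. by []. Qed.

Lemma crossed_mul_gen_bal a g :
  balanced (@pact R S A) P_lact
    (fun b h => lmul a (rmul h (twist g b))).
Proof.
have bb := bmul_biadd A; have n1 := mx_of_nnz (a # g).
split; first split=> [b c h|b h h'].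
- apply: mx_of_ext => i j; rewrite mx_ofD mxD !mx_of_lrt.
  by rewrite (hash_biadd.1 b c) mx_ofD (mxmulDr bb).
- apply: mx_of_ext => i j; rewrite mx_ofD mxD !mx_of_lrt.
  by rewrite (hash_biadd.2 b h h') mx_ofD (mxmulDr bb).
- by move=> b p h; apply: mx_of_ext => i j; rewrite !mx_of_lrt hash_bal.
Qed.

Lemma mx_of_mul_gen a g y :
  mx_of (crossed_mul_gen a g y) = mxmul (@bmul R A) (mx_of (a # g)) (mx_of y).
Proof.
have bb := bmul_biadd A; have n1 := mx_of_nnz (a # g).
have bal := crossed_mul_gen_bal a g; rewrite /crossed_mul_gen.
elim/tensor_ind: y => [|x y hx hy|b h].
- rewrite (tensor_lift0 bal) mx_of0; apply/funext => i; apply/funext => j.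
  by rewrite /mxmul fsbig1 // => k _; rewrite (bi0r bb).
- by rewrite (tensor_liftD bal) !mx_ofD (mxmulDr bb) // hx hy.
- rewrite (tensor_lift_tens bal) -/(hash b h).
  by apply/funext => i; apply/funext => j; rewrite mx_of_lrt.
Qed.

Lemma crossed_mul_bal y :
  balanced (@pact R S A) P_lact
    (fun a g => crossed_mul_gen a g y).
Proof.
have bb := bmul_biadd A.
split; first split=> [b c h|b h h'].
- apply: mx_of_inj; rewrite mx_ofD !mx_of_mul_gen.
  by rewrite (hash_biadd.1 b c) mx_ofD (mxmulDl bb) //; apply: mx_of_nnz.
- apply: mx_of_inj; rewrite mx_ofD !mx_of_mul_gen.
  by rewrite (hash_biadd.2 b h h') mx_ofD (mxmulDl bb) //; apply: mx_of_nnz.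
- by move=> b p h; apply: mx_of_inj; rewrite !mx_of_mul_gen hash_bal.
Qed.

Lemma mx_of_mul x y :
  mx_of (crossed_mul x y) = mxmul (@bmul R A) (mx_of x) (mx_of y).
Proof.
have bb := bmul_biadd A; have bal := crossed_mul_bal y; rewrite /crossed_mul.
elim/tensor_ind: x => [|x z hx hz|a g].
- rewrite (tensor_lift0 bal) mx_of0; apply/funext => i; apply/funext => j.
  by rewrite /mxmul fsbig1 // => k _; rewrite (bi0l bb).
- rewrite (tensor_liftD bal) !mx_ofD (mxmulDl bb) ?hx ?hz //; exact: mx_of_nnz.
- by rewrite (tensor_lift_tens bal) -/(hash a g) mx_of_mul_gen.
Qed.

Lemma crossed_mulE a b f g :
  crossed_mul (a # U f) (b # U g) = smul a (spush f b) # U (emb_comp f g).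
Proof.
rewrite /crossed_mul (tensor_lift_tens (crossed_mul_bal _)).
rewrite /crossed_mul_gen (tensor_lift_tens (crossed_mul_gen_bal _ _)) twistU.
rewrite /rmul (tensor_lift_tens (rmul_bal _)) /lmul (tensor_lift_tens (lmul_bal _)).
by rewrite U_mul.
Qed.

(* the P-bimodule structure p (a # g) q = (p a) # (g q) *)

Definition crossed_lact (p : Pring) : T -> T := tensor_lift (fun a g => pact a p # g).
Definition crossed_ract (x : T) (p : Pring) : T :=
  tensor_lift (fun a g => a # (g * P_val p)) x.

Lemma crossed_lact_bal p :
  balanced (@pact R S A) P_lact
    (fun a g => pact a p # g).
Proof.
have [hl hr] := hash_biadd; split.
  by split=> *; rewrite ?(pact_biadd S A).1 ?hl ?hr.
by move=> a q g; rewrite -hash_bal pactC.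
Qed.

Lemma mx_of_lact p x i j : mx_of (crossed_lact p x) i j = mx_of x i j *~ P_val p i i.
Proof.
have bal := crossed_lact_bal p; rewrite /crossed_lact.
elim/tensor_ind: x => [|x y hx hy|a g].
- by rewrite (tensor_lift0 bal) mx_of0 mul0rz.
- by rewrite (tensor_liftD bal) !mx_ofD !mxD hx hy mulrzDl.
- by rewrite (tensor_lift_tens bal) -/(hash a g) !mx_of_hash /= mulrzAC.
Qed.

Lemma mx_of_ract p x i j : mx_of (crossed_ract x p) i j = mx_of x i j *~ P_val p j j.
Proof.
have bal := rmul_bal (P_val p); rewrite /crossed_ract.
elim/tensor_ind: x => [|x y hx hy|a g].
- by rewrite (tensor_lift0 bal) mx_of0 mul0rz.
- by rewrite (tensor_liftD bal) !mx_ofD !mxD hx hy mulrzDl.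
- by rewrite (tensor_lift_tens bal) -/(hash a g) !mx_of_hash mul_P_diag mulrzA.
Qed.
End Crossed.

Section CrossedAlgebra.
Variables (R : realType) (S : symIdeal R) (A : bornAlg R).
Local Notation T := (crossed_tensor S A).

Lemma crossed_mulA : associative (@crossed_mul R S A).
Proof.
move=> x y z; have b := bmul_biadd A; apply: mx_of_inj; rewrite !mx_of_mul.
by apply: (mxmulA b b b b); [apply: bmulA|apply: mx_of_nnz..].
Qed.
Lemma crossed_mul_biadd : biadditive (@crossed_mul R S A).
Proof.
have b := bmul_biadd A.
split=> x y z; apply: mx_of_inj; rewrite mx_ofD !mx_of_mul mx_ofD.
  by rewrite (mxmulDl b) //; apply: mx_of_nnz.
by rewrite (mxmulDr b) //; apply: mx_of_nnz.
Qed.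
Lemma crossed_lact_biadd : biadditive (@crossed_lact R S A).
Proof.
split=> [p q x|p x y]; apply: mx_of_ext => i j; rewrite mx_ofD mxD !mx_of_lact.
  by rewrite mulrzDr.
by rewrite mx_ofD mxD mulrzDl.
Qed.
Lemma crossed_ract_biadd : biadditive (@crossed_ract R S A).
Proof.
split=> [x y p|x p q]; apply: mx_of_ext => i j; rewrite mx_ofD mxD !mx_of_ract.
  by rewrite mx_ofD mxD mulrzDl.
by rewrite mulrzDr.
Qed.
Lemma P_diag1 i : P_val 1 i i = 1.
Proof. by rewrite -[LHS]/(Gamma_one i i) Gamma_oneE eqxx. Qed.
Lemma crossed_lact1 (x : T) : crossed_lact 1 x = x.
Proof. by apply: mx_of_ext => i j; rewrite mx_of_lact P_diag1 mulr1z. Qed.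
Lemma crossed_ract1 (x : T) : crossed_ract x 1 = x.
Proof. by apply: mx_of_ext => i j; rewrite mx_of_ract P_diag1 mulr1z. Qed.
Lemma crossed_lactM p q (x : T) :
  crossed_lact (p * q) x = crossed_lact p (crossed_lact q x).
Proof.
by apply: mx_of_ext => i j; rewrite !mx_of_lact P_diagM mulrC mulrzA.
Qed.
Lemma crossed_ractM p q (x : T) :
  crossed_ract x (p * q) = crossed_ract (crossed_ract x p) q.
Proof. by apply: mx_of_ext => i j; rewrite !mx_of_ract P_diagM mulrzA. Qed.
Lemma crossed_bimod p q (x : T) :
  crossed_ract (crossed_lact p x) q = crossed_lact p (crossed_ract x q).
Proof. by apply: mx_of_ext => i j; rewrite !(mx_of_ract, mx_of_lact) mulrzAC. Qed.
Lemma crossed_mul_lact p (x y : T) :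
  crossed_mul (crossed_lact p x) y = crossed_lact p (crossed_mul x y).
Proof.
apply: mx_of_ext => i j; rewrite mx_of_lact !mx_of_mul.
by apply: (mxmulZl (bmul_biadd A)) => [|k]; [apply: mx_of_nnz|rewrite mx_of_lact].
Qed.
Lemma crossed_mul_ract p (x y : T) :
  crossed_mul x (crossed_ract y p) = crossed_ract (crossed_mul x y) p.
Proof.
apply: mx_of_ext => i j; rewrite mx_of_ract !mx_of_mul.
by apply: (mxmulZr (bmul_biadd A)) => [|k]; [apply: mx_of_nnz|rewrite mx_of_ract].
Qed.
Lemma crossed_mul_mid p (x y : T) :
  crossed_mul (crossed_ract x p) y = crossed_mul x (crossed_lact p y).
Proof.
apply: mx_of_ext => i j; rewrite !mx_of_mul.
apply: (mxmulZm (bmul_biadd A) (d := fun k => P_val p k k)) => k.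
  by rewrite mx_of_ract.
by rewrite mx_of_lact.
Qed.

Definition crossed : palgebra := PAlgebra crossed_mulA crossed_mul_biadd
  crossed_lact_biadd crossed_lact1 crossed_lactM
  crossed_ract_biadd crossed_ract1 crossed_ractM crossed_bimod
  crossed_mul_lact crossed_mul_ract crossed_mul_mid.
End CrossedAlgebra.
Arguments crossed {R} S A.

Definition Imx (R : realType) (S : symIdeal R) (A : bornAlg R)
    (M : nat -> nat -> A) : Prop :=
  fam S (fun ij : nat * nat => M ij.1 ij.2) /\ nnz_finite M.

Section GammaInf.
Variables (R : realType) (A : bornAlg R).
Local Notation C := R[i].

Lemma fam_linf (S : symIdeal R) (X : Type) (a : X -> A) : fam S a -> fam (linf R) a.
Proof.
by move=> [D [b [ba [e eb /si_bounded Sb]]]]; exists D, b; split=> //; exists e.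
Qed.

Lemma Imx_linf (S : symIdeal R) (M : nat -> nat -> A) : Imx S M -> Imx (linf R) M.
Proof. by move=> [/fam_linf]. Qed.

Lemma ImxP (M : nat -> nat -> A) : Imx (linf R) M <->
  (exists (D : disk A) (K : C), forall i j,
     exists2 x : bspace D, bincl D x = M i j & `|x| <= K) /\ nnz_finite M.
Proof.
have [e eb] := nat2_bij; split=> -[h nM]; split=> //.
  move: h => [D [b [ba /si_on_linf hb]]].
  have [|K bK] := hb; first by exists e.
  by exists D, K => i j; exists (b (i, j)); rewrite ?ba //; have := bK (i, j); rewrite normr_id.
move: h => [D [K h]].
have /choice[b hb] (ij : nat * nat) : exists x : bspace D,
    bincl D x = M ij.1 ij.2 /\ `|x| <= K.
  by have [x ? ?] := h ij.1 ij.2; exists x.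
exists D, b; split=> [x|]; first by case: (hb x).
apply/si_on_linf; first by exists e.
by exists K => x; rewrite normr_id; case: (hb x).
Qed.

Definition GammaInf_mem : {pred (nat -> nat -> A)} := fun M => `[< Imx (linf R) M >].

Lemma GammaInf_zmod_closed : zmod_closed GammaInf_mem.
Proof.
split=> [|M N /asboolP/ImxP[[D [K MK]] nM] /asboolP/ImxP[[D' [K' NK]] nN]].
  apply/asboolP/ImxP; split; last exact: nnz_finite0.
  have [D _] := bv_union (0 : A); exists D, 0 => i j.
  by exists 0; rewrite ?linear0 ?normr0.
apply/asboolP/ImxP; split; last exact: nnz_finiteB.
have [E [L [L' [h h']]]] := bshare D D'.
exists E, (`|L| * K + `|L'| * K') => i j.
have [x xe xK] := MK i j; have [x' xe' xK'] := NK i j.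
have [y ye yL] := h x; have [y' ye' yL'] := h' x'.
exists (y - y'); first by rewrite linearB ye ye' xe xe'.
have le (F : disk A) (B c : C) (v : bspace F) (w : bspace E) :
    `|w| <= c * `|v| -> `|v| <= B -> `|w| <= `|c| * B.
  move=> wc vB; have := norm_le_ge0 wc; move=> cv0.
  have e : `|c| * `|v| = c * `|v| by rewrite -[RHS](ger0_norm cv0) normrM normr_id.
  by apply: le_trans wc _; rewrite -e ler_wpM2l.
apply: le_trans (ler_normB _ _) _.
by apply: lerD; [apply: le yL xK|apply: le yL' xK'].
Qed.
HB.instance Definition _ :=
  GRing.isZmodClosed.Build (nat -> nat -> A) GammaInf_mem GammaInf_zmod_closed.

(* Gamma^oo(A) = I_(l^oo(A)) *)
Record GammaInf_type := MkGammaInf {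
  GammaInf_val :> nat -> nat -> A; _ : GammaInf_val \in GammaInf_mem }.
HB.instance Definition _ := [isSub for GammaInf_val].
HB.instance Definition _ := [Choice of GammaInf_type by <:].
HB.instance Definition _ := [SubChoice_isSubZmodule of GammaInf_type by <:].

Local Notation G := GammaInf_type.

Lemma GammaInfP (M : G) :
  (exists (D : disk A) (K : C), forall i j,
     exists2 x : bspace D, bincl D x = M i j & `|x| <= K) /\ nnz_finite M.
Proof. by case: M => M /= /asboolP/ImxP. Qed.

Lemma GammaInf_nnz (M : G) : nnz_finite M.
Proof. by case: (GammaInfP M). Qed.

Lemma GammaInf_ext (M N : G) : (forall i j, M i j = N i j) -> M = N.
Proof. by move=> MN; apply/val_inj/funext => i; apply/funext => j; apply: MN. Qed.

Lemma GammaInf_valD (M N : G) i j : (M + N) i j = M i j + N i j.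
Proof. by []. Qed.

Lemma GammaInf_mul_mem (M N : G) : mxmul (@bmul R A) M N \in GammaInf_mem.
Proof.
have bb := bmul_biadd A.
have [[D [K MK]] nM] := GammaInfP M; have [[D' [K' NK]] nN] := GammaInfP N.
apply/asboolP/ImxP; split; last exact: nnz_finite_mul.
have [E [L [L0 h]]] := bmul_norm D D'.
move/nnz_finiteP: (nM) => [n [r [c [sz hr]]]].
have K0 : 0 <= K by have [x _ /norm_le_ge0] := MK 0%N 0%N.
have K'0 : 0 <= K' by have [x _ /norm_le_ge0] := NK 0%N 0%N.
exists E, ((L * K * K') *+ n) => i k.
have us : uniq (undup (r i)) by apply: undup_uniq.
rewrite (mxmulE bb _ _ us) => [|j /hr[]]; last by rewrite mem_undup.
have : (size (undup (r i)) <= n)%N.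
  by apply: leq_trans (size_undup _) _; case: (sz i).
move=> sn; suff [x xe xK] : exists2 x : bspace E,
    bincl E x = \sum_(j <- undup (r i)) bmul (M i j) (N j k) &
    `|x| <= (L * K * K') *+ size (undup (r i)).
  by exists x => //; apply: le_trans xK _; apply: ler_wpMn2l => //; rewrite !mulr_ge0.
elim: (undup (r i)) => [|j s [x xe xK]].
  by exists 0; rewrite ?big_nil ?linear0 ?normr0.
have [u ue uK] := MK i j; have [v ve vK] := NK j k.
have [w we wK] := h u v; exists (w + x).
  by rewrite big_cons linearD we xe ue ve.
rewrite /= mulrS; apply: le_trans (ler_normD _ _) _; apply: lerD => //.
apply: le_trans wK _; apply: ler_pM => //; first exact: mulr_ge0.
exact: ler_wpM2l.
Qed.
Definition GammaInf_mul (M N : G) : G := MkGammaInf (GammaInf_mul_mem M N).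

Lemma mxmul_Pl (p : Pring) (M : nat -> nat -> A) i j :
  mxmul (fun (z : int) (a : A) => a *~ z) (P_val p) M i j = M i j *~ P_val p i i.
Proof.
rewrite (@mxmulE _ _ _ _ (biadditive_zl A) _ _ [:: i]) ?big_seq1 // => k.
by apply: contraR; rewrite inE => ki; rewrite P_diag // eq_sym.
Qed.

Lemma mxmul_Pr (p : Pring) (M : nat -> nat -> A) i j : nnz_finite M ->
  mxmul (fun (a : A) (z : int) => a *~ z) M (P_val p) i j = M i j *~ P_val p j j.
Proof.
move=> /nnz_rows[r h].
have us : uniq (undup (j :: r i)) by apply: undup_uniq.
rewrite (mxmulE (biadditive_zr A) _ _ us); last first.
  by move=> k /(h i).2 kr; rewrite mem_undup inE kr orbT.
rewrite (bigD1_seq j) ?mem_undup ?inE ?eqxx //= big1 ?addr0 // => k kj.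
by rewrite P_diag ?mulr0z.
Qed.

Lemma GammaInf_scale_mem (M : G) (N : nat -> nat -> A) (z : nat -> nat -> int) (b : nat) :
  (forall i j, `|z i j| <= b%:Z) -> (forall i j, N i j = M i j *~ z i j) ->
  N \in GammaInf_mem.
Proof.
move=> zb NM; have [[D [K MK]] nM] := GammaInfP M; apply/asboolP/ImxP; split.
  exists D, (K *+ b) => i j; have [x xe xK] := MK i j.
  exists (x *~ z i j); first by rewrite raddfMz /= xe NM.
  have nz (v : bspace D) (n : int) : `|v *~ n| = `|v| *+ `|n|%N.
    by case: n => k; rewrite ?NegzE ?mulrNz ?normrN -?pmulrn normrMn.
  rewrite nz; apply: (@le_trans _ _ (K *+ `|z i j|%N)); first by rewrite lerMn2r xK orbT.
  apply: ler_wpMn2l; first exact: norm_le_ge0 xK.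
  by have := zb i j; rewrite -abszE lez_nat.
apply: nnz_finite_sub nM => i j; rewrite NM.
by apply: contraNneq => ->; rewrite mul0rz.
Qed.

Lemma GammaInf_lact_mem (p : Pring) (M : G) :
  mxmul (fun (z : int) (a : A) => a *~ z) (P_val p) M \in GammaInf_mem.
Proof.
have [_ [b pb]] := GammaP (P_val p).
by apply: (GammaInf_scale_mem (fun i j => pb i i)) => i j; apply: mxmul_Pl.
Qed.
Lemma GammaInf_ract_mem (M : G) (p : Pring) :
  mxmul (fun (a : A) (z : int) => a *~ z) M (P_val p) \in GammaInf_mem.
Proof.
have [_ [b pb]] := GammaP (P_val p).
apply: (GammaInf_scale_mem (fun i j => pb j j)) => i j; apply: mxmul_Pr.
exact: GammaInf_nnz.
Qed.
Definition GammaInf_lact (p : Pring) (M : G) : G := MkGammaInf (GammaInf_lact_mem p M).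
Definition GammaInf_ract (M : G) (p : Pring) : G := MkGammaInf (GammaInf_ract_mem M p).

Lemma GammaInf_lactE p M i j : GammaInf_lact p M i j = M i j *~ P_val p i i.
Proof. exact: mxmul_Pl. Qed.
Lemma GammaInf_ractE p M i j : GammaInf_ract M p i j = M i j *~ P_val p j j.
Proof. by apply: mxmul_Pr; apply: GammaInf_nnz. Qed.

Lemma GammaInf_mulA : associative GammaInf_mul.
Proof.
move=> x y z; have b := bmul_biadd A; apply: val_inj.
by apply: (mxmulA b b b b); [apply: bmulA|apply: GammaInf_nnz..].
Qed.
Lemma GammaInf_mul_biadd : biadditive GammaInf_mul.
Proof.
have b := bmul_biadd A; split=> x y z; apply: val_inj.
  by apply: (mxmulDl b); apply: GammaInf_nnz.
by apply: (mxmulDr b); apply: GammaInf_nnz.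
Qed.
Lemma GammaInf_lact_biadd : biadditive GammaInf_lact.
Proof.
split=> [p q x|p x y]; apply: GammaInf_ext => i j;
  rewrite GammaInf_valD !GammaInf_lactE ?GammaInf_valD.
  by rewrite mulrzDr.
by rewrite mulrzDl.
Qed.
Lemma GammaInf_ract_biadd : biadditive GammaInf_ract.
Proof.
split=> [x y p|x p q]; apply: GammaInf_ext => i j;
  rewrite GammaInf_valD !GammaInf_ractE ?GammaInf_valD.
  by rewrite mulrzDl.
by rewrite mulrzDr.
Qed.
Lemma GammaInf_lact1 x : GammaInf_lact 1 x = x.
Proof. by apply: GammaInf_ext => i j; rewrite GammaInf_lactE P_diag1 mulr1z. Qed.
Lemma GammaInf_ract1 x : GammaInf_ract x 1 = x.
Proof. by apply: GammaInf_ext => i j; rewrite GammaInf_ractE P_diag1 mulr1z. Qed.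
Lemma GammaInf_lactM p q x :
  GammaInf_lact (p * q) x = GammaInf_lact p (GammaInf_lact q x).
Proof.
by apply: GammaInf_ext => i j; rewrite !GammaInf_lactE P_diagM mulrC mulrzA.
Qed.
Lemma GammaInf_ractM p q x :
  GammaInf_ract x (p * q) = GammaInf_ract (GammaInf_ract x p) q.
Proof. by apply: GammaInf_ext => i j; rewrite !GammaInf_ractE P_diagM mulrzA. Qed.
Lemma GammaInf_bimod p q x :
  GammaInf_ract (GammaInf_lact p x) q = GammaInf_lact p (GammaInf_ract x q).
Proof.
by apply: GammaInf_ext => i j; rewrite !(GammaInf_ractE, GammaInf_lactE) mulrzAC.
Qed.
Lemma GammaInf_mul_lact p x y :
  GammaInf_mul (GammaInf_lact p x) y = GammaInf_lact p (GammaInf_mul x y).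
Proof.
apply: GammaInf_ext => i j; rewrite GammaInf_lactE.
by apply: (mxmulZl (bmul_biadd A)) => [|k]; [apply: GammaInf_nnz|rewrite GammaInf_lactE].
Qed.
Lemma GammaInf_mul_ract p x y :
  GammaInf_mul x (GammaInf_ract y p) = GammaInf_ract (GammaInf_mul x y) p.
Proof.
apply: GammaInf_ext => i j; rewrite GammaInf_ractE.
by apply: (mxmulZr (bmul_biadd A)) => [|k]; [apply: GammaInf_nnz|rewrite GammaInf_ractE].
Qed.
Lemma GammaInf_mul_mid p x y :
  GammaInf_mul (GammaInf_ract x p) y = GammaInf_mul x (GammaInf_lact p y).
Proof.
apply: GammaInf_ext => i j.
apply: (mxmulZm (bmul_biadd A) (d := fun k => P_val p k k)) => k.
  by rewrite GammaInf_ractE.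
by rewrite GammaInf_lactE.
Qed.

Definition GammaInf : palgebra := PAlgebra GammaInf_mulA GammaInf_mul_biadd
  GammaInf_lact_biadd GammaInf_lact1 GammaInf_lactM
  GammaInf_ract_biadd GammaInf_ract1 GammaInf_ractM GammaInf_bimod
  GammaInf_mul_lact GammaInf_mul_ract GammaInf_mul_mid.

End GammaInf.

Definition palg_ideal (B : palgebra) (I : set B) : Prop :=
  [/\ I 0, (forall x y, I x -> I y -> I (x - y)),
      (forall x y, I y -> I (pa_mul x y) /\ I (pa_mul y x)) &
      (forall p y, I y -> I (pa_lact p y) /\ I (pa_ract y p))].

Definition IS (R : realType) (S : symIdeal R) (A : bornAlg R) : set (GammaInf A) :=
  [set M : GammaInf_type A | Imx S M].
Arguments IS {R} S A.

Definition diagU (V : zmodType) (a : nat -> V) (f : Emb) : nat -> nat -> V :=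
  fun i j => if f j == Some i then a i else 0.

(* the homomorphism S(A) # Gamma -> l^oo(A) # Gamma induced by S(A) in l^oo(A) *)
Section Inclusion.
Variables (R : realType) (S : symIdeal R) (A : bornAlg R).

Lemma seq_incl_mem (a : seqS S A) : seq_val a \in fam_mem (linf R) A.
Proof. by case: a => a /= /asboolP/fam_linf h; apply/asboolP. Qed.
Definition seq_incl (a : seqS S A) : seqS (linf R) A := MkSeqS (seq_incl_mem a).

Definition incl_fun : crossed S A -> crossed (linf R) A :=
  tensor_lift (fun a g => hash (seq_incl a) g).

Lemma incl_bal : balanced (@pact R S A) P_lact
  (fun a g => hash (seq_incl a) g).
Proof.
have [hl hr] := @hash_biadd R (linf R) A; split.
  split=> [a b g|a g h]; rewrite ?hr // -hl; congr hash; exact: seqS_ext.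
by move=> a p g; rewrite -hash_bal; congr hash; apply: seqS_ext.
Qed.

Lemma incl_hash (a : seqS S A) g : incl_fun (hash a g) = hash (seq_incl a) g.
Proof. exact: (tensor_lift_tens incl_bal). Qed.

Lemma mx_of_incl (x : crossed_tensor S A) : mx_of (incl_fun x) = mx_of x.
Proof.
elim/tensor_ind: x => [|x y hx hy|a g].
- by rewrite /incl_fun (tensor_lift0 incl_bal) !mx_of0.
- by rewrite /incl_fun (tensor_liftD incl_bal) !mx_ofD -hx -hy.
- apply/funext => i; apply/funext => j.
  by rewrite -/(hash a g) incl_hash !mx_of_hash.
Qed.

Lemma incl_add x y : incl_fun (x + y) = incl_fun x + incl_fun y.
Proof. exact: (tensor_liftD incl_bal). Qed.
Lemma incl_mul x y : incl_fun (pa_mul x y) = pa_mul (incl_fun x) (incl_fun y).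
Proof.
apply: mx_of_inj; rewrite [RHS](mx_of_mul (incl_fun x)) !mx_of_incl.
exact: mx_of_mul.
Qed.
Lemma incl_lact p x : incl_fun (pa_lact p x) = pa_lact p (incl_fun x).
Proof.
apply: mx_of_ext => i j; rewrite [RHS](mx_of_lact p (incl_fun x)) !mx_of_incl.
exact: mx_of_lact.
Qed.
Lemma incl_ract p x : incl_fun (pa_ract x p) = pa_ract (incl_fun x) p.
Proof.
apply: mx_of_ext => i j; rewrite [RHS](mx_of_ract p (incl_fun x)) !mx_of_incl.
exact: mx_of_ract.
Qed.

Definition crossed_incl : palg_hom (crossed S A) (crossed (linf R) A) :=
  PAlgHom incl_add incl_mul incl_lact incl_ract.
End Inclusion.
Arguments crossed_incl {R} S A.

(* Main.v *)
(** Cut a matrix with uniformly bounded numbers of nonzero entries per row and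
    column into finitely many pieces [diag a * U f], each [f] a partial
    injection. For a symmetric ideal [S], such a piece lies in [I_S(A)] exactly
    when [a] can be taken in [S(A)], because its entries form a sequence
    obtained from [a] by a partial injection, and conversely. This gives
    surjectivity onto [I_S(A)]. Injectivity ([mx_of_inj]) holds because a
    tensor is a sum of [a_k # U_(f_k)] with the graphs of the [f_k] pairwise
    disjoint. The ideal property follows from [(diag a U_f) (diag b U_g) = diag (a f_*(b)) U_fg]. *)
Require Import Defs.
From mathcomp Require Import all_boot all_order all_algebra.
From mathcomp Require Import boolp classical_sets functions reals.
From mathcomp Require Import topology normedtype complex.

Local Open Scope classical_set_scope.

Import Order.TTheory GRing.Theory Num.Theory.
Import numFieldNormedType.Exports.

Set Implicit Arguments.
Unset Strict Implicit.

(** * Families in S(X, A): reindexing, symmetry, products *)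

Section Families.
Variables (R : realType) (A : bornAlg R).
Local Open Scope ring_scope.

(** [si_on] only asks for some bijection from the naturals, which can be composed with [e] or its
    inverse. With [nat2_bij] this lets a matrix be treated as a sequence. *)
Lemma fam_reindex (S : symIdeal R) (X Y : Type) (e : X -> Y) (a : Y -> A) :
  bijective e -> fam S a <-> fam S (a \o e).
Proof.
move=> [e' ee' e'e]; split=> [[D [b [ba [c cb Sc]]]]|[D [b [ba [c cb Sc]]]]].
  exists D, (b \o e); split=> [x|]; first exact: ba.
  exists (e' \o c); first by apply: bij_comp cb; exists e.
  suff -> : (fun x => `|(b \o e) x|) \o (e' \o c) = (fun y => `|b y|) \o c by [].
  by apply/funext => n /=; rewrite e'e.
exists D, (b \o e'); split=> [y|]; first by rewrite /= ba /= e'e.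
exists (e \o c); first by apply: bij_comp cb; exists e'.
suff -> : (fun y => `|(b \o e') y|) \o (e \o c) = (fun x => `|b x|) \o c by [].
by apply/funext => n /=; rewrite ee'.
Qed.

Lemma fam_push (S : symIdeal R) (f : Emb) (a : nat -> A) :
  fam S a -> fam S (push f a).
Proof.
move=> /asboolP Sa; apply/asboolP.
exact: (spush_mem f (MkSeqS (Sa : a \in fam_mem S A))).
Qed.

(** The norms of the products are dominated by M |x_n| |y_n|, and S is solid. Three ideals are
    allowed so that both S times l^oo and l^oo times S are covered. *)
Lemma fam_bmul (S1 S2 S : symIdeal R) (a b : nat -> A) :
  (forall x y, S1 x -> S2 y -> S (fun n => x n * y n)) ->
  fam S1 a -> fam S2 b -> fam S (fun n => bmul (a n) (b n)).
Proof.
move=> S12 /fam_natE[D1 [x [xa Sx]]] /fam_natE[D2 [y [yb Sy]]].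
have [D3 [M [M0 h]]] := bmul_norm D1 D2.
have /choice[z hz] n : exists z : bspace D3, bincl D3 z = bmul (a n) (b n) /\
    `|z| <= M * `|x n| * `|y n|.
  by have [z ze zM] := h (x n) (y n); exists z; rewrite ze xa yb.
apply/fam_natE; exists D3, z; split=> [n|]; first by case: (hz n).
apply: (@si_solid _ _ (fun n => M * (`|x n| * `|y n|))) => [|n].
  by apply: si_M; [exact: bounded_seq_cst|exact: S12].
by have [_ zM] := hz n; rewrite normr_id mulrA ger0_norm // !mulr_ge0.
Qed.

End Families.

(** * The matrices of S(A) # Gamma are exactly those of I_S(A) *)

Section Surjectivity.
Variables (R : realType) (S : symIdeal R) (A : bornAlg R).
Local Open Scope ring_scope.

Lemma Imx0 : Imx S (0 : nat -> nat -> A).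
Proof.
have [e eb] := nat2_bij; split; last exact: nnz_finite0.
by apply/(fam_reindex _ _ eb)/asboolP; have [] := fam_zmod_closed A S.
Qed.

Lemma ImxB (M N : nat -> nat -> A) : Imx S M -> Imx S N -> Imx S (M - N).
Proof.
have [e eb] := nat2_bij; move=> [SM nM] [SN nN]; split; last exact: nnz_finiteB.
move: SM SN => /(fam_reindex _ _ eb)/asboolP SM.
move=> /(fam_reindex _ _ eb)/asboolP SN.
have [_ SB] := fam_zmod_closed A S.
by apply/(fam_reindex _ _ eb)/asboolP; apply: (SB _ _ SM SN).
Qed.

Lemma mx_of_hashU (a : seqS S A) (f : Emb) : mx_of (hash a (U f)) = diagU a f.
Proof.
apply/funext => i; apply/funext => j; rewrite mx_of_hash U_val /diagU.
by case: ifP.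
Qed.

Lemma Imx_diagU (a : nat -> A) (f : Emb) : fam S a -> Imx S (diagU a f).
Proof.
move=> Sa; split; last first.
  apply: nnz_finite_sub (Gamma_nnz (U f)) => i j.
  by rewrite U_val /diagU; case: ifP; rewrite ?eqxx.
have [e [e' ee' e'e]] := nat2_bij.
apply/(@fam_reindex _ _ _ _ _ e); first by exists e'.
(* [g] sends a row i in the range of [f] to the index of the only position of that row on the graph
   of [f]. *)
pose g i := omap (fun j => e' (i, j)) (emb_dag f i).
have gE i n : g i = Some n <-> (e n).1 = i /\ f (e n).2 = Some i.
  rewrite /g; split.
    case fi: (emb_dag f i) => [j|] //= [<-]; rewrite e'e /=.
    by split=> //; apply/emb_dagP.
  case=> ei /emb_dagP -> /=; congr Some; rewrite -[RHS]ee'; congr e'.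
  by case: (e n) ei => ? ? /= ->.
have gi i j k : g i = Some k -> g j = Some k -> i = j.
  by move=> /gE[<- _] /gE[].
suff -> : (fun ij => diagU a f ij.1 ij.2) \o e = push (MkEmb gi) a by exact: fam_push.
apply/funext => n; rewrite /diagU /=; case: eqP => fe.
  by rewrite (@push_some _ _ _ (e n).1 n) //; apply/gE.
(* A position off the graph of [f] has an index outside the range of [g], so both sides vanish. *)
rewrite /push; case d: (emb_dag _ n) => [m|] //.
by move/emb_dagP: d => /gE[en]; rewrite -en.
Qed.

Lemma Imx_mx_of (x : crossed_tensor S A) : Imx S (mx_of x).
Proof.
elim/hash_ind: x => [|x y hx hy|a f].
- by rewrite mx_of0; apply: Imx0.
- by rewrite mx_ofB; apply: ImxB.
- by rewrite mx_of_hashU; apply: Imx_diagU; case: a => a /= /asboolP.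
Qed.

Lemma mx_of_surj (M : nat -> nat -> A) :
  Imx S M -> exists x : crossed_tensor S A, mx_of x = M.
Proof.
move=> [SM nM]; have [n [f [_ Mf]]] := nnz_decomp nM.
have [e [e' ee' e'e]] := nat2_bij.
have eb : bijective e by exists e'.
move/(fam_reindex _ _ eb): SM => SM.
(* [g k] goes the other way: it sends the index of a position on the graph of [f k] to its row.
   Pushing the entries of M along it collects, row by row, the coefficients [a k] of the k-th
   piece. *)
pose g k m := if f k (e m).2 == Some (e m).1 then Some (e m).1 else None.
have gE k m i : g k m = Some i <-> (e m).1 = i /\ f k (e m).2 = Some i.
  rewrite /g; case: eqP => fe; last by split=> // -[ei fi]; case: fe; rewrite ei.
  by split=> [[<-]|[-> //]].
have gi k i j l : g k i = Some l -> g k j = Some l -> i = j.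
  move=> /gE[i1 i2] /gE[j1 j2]; apply: (can_inj ee').
  by rewrite [e i]surjective_pairing [e j]surjective_pairing i1 j1 (emb_inj i2 j2).
pose a k : seqS S A := MkSeqS (asboolT (fam_push (MkEmb (gi k)) SM)).
exists (\sum_(k < n) hash (a k) (U (f k))).
rewrite mx_of_sum; apply/funext => i; apply/funext => j.
rewrite mx_sum_val [RHS]Mf; apply: eq_bigr => k _; rewrite mx_of_hashU /diagU.
case: eqP => // fk; rewrite /= (@push_some _ _ _ (e' (i, j)) i) /= ?e'e //.
by apply/gE; rewrite e'e.
Qed.

End Surjectivity.

(** * I_S(A) is an ideal and a sub-bimodule *)

Section Ideal.
Variables (R : realType) (S : symIdeal R) (A : bornAlg R).
Local Open Scope ring_scope.

Lemma Imx_mul_hash (S1 S2 : symIdeal R) (x : crossed S1 A) (y : crossed S2 A) :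
  (forall u v, S1 u -> S2 v -> S (fun n => u n * v n)) ->
  Imx S (mxmul (@bmul R A) (mx_of x) (mx_of y)).
Proof.
(* Both factors are moved into l^oo(A) # Gamma, where they can be multiplied; biadditivity then
   leaves only products of generators. *)
move=> S12; rewrite -(mx_of_incl x) -(mx_of_incl y) -mx_of_mul.
have cb := crossed_mul_biadd (linf R) A; have [cl cr] := cb.
have add0 S' : incl_fun (0 : crossed_tensor S' A) = 0.
  by apply: mx_of_inj; rewrite mx_of_incl !mx_of0.
have addB S' (u v : crossed_tensor S' A) :
    incl_fun (u - v) = incl_fun u - incl_fun v.
  by apply: mx_of_inj; rewrite mx_ofB !mx_of_incl mx_ofB.
elim/hash_ind: x => [|x x' hx hx'|a f].
- by rewrite add0 (bi0l cb) mx_of0; apply: Imx0.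
- by rewrite addB cl (biNl cb) mx_ofB; apply: ImxB.
elim/hash_ind: y => [|y y' hy hy'|b g].
- by rewrite add0 (bi0r cb) mx_of0; apply: Imx0.
- by rewrite addB cr (biNr cb) mx_ofB; apply: ImxB.
(* The coefficient of the product is a f_*(b), and f_*(b) stays in S2(A) by symmetry. *)
rewrite !incl_hash crossed_mulE mx_of_hashU; apply: Imx_diagU.
apply: (@fam_bmul _ _ S1 S2) => //; first by case: a => a /= /asboolP.
by apply: fam_push; case: b => b /= /asboolP.
Qed.

Lemma Imx_mul (S1 S2 : symIdeal R) (M N : nat -> nat -> A) :
  (forall u v, S1 u -> S2 v -> S (fun n => u n * v n)) ->
  Imx S1 M -> Imx S2 N -> Imx S (mxmul (@bmul R A) M N).
Proof.
by move=> S12 /mx_of_surj[x <-] /mx_of_surj[y <-]; apply: Imx_mul_hash.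
Qed.

Lemma IS_ideal : palg_ideal (IS S A).
Proof.
have SM u v : linf R u -> S v -> S (fun n => u n * v n) by exact: si_M.
have MS u v : S u -> linf R v -> S (fun n => u n * v n).
  move=> Su lv; rewrite (_ : (fun n => _) = (fun n => v n * u n)); first exact: si_M.
  by apply/funext => n; rewrite mulrC.
split=> [|M N|M N SN|p N].
- exact: Imx0.
- exact: ImxB.
- have /asboolP lM : GammaInf_val M \in @GammaInf_mem R A by case: (M).
  by split; [exact: Imx_mul SM lM SN|exact: Imx_mul MS SN lM].
(* As N is the matrix of a tensor x over S(A), p N and N p are the matrices of p x and x p. *)
- move=> /mx_of_surj[x xN]; split.
    suff : GammaInf_val (GammaInf_lact p N) = mx_of (crossed_lact p x).
      by rewrite /IS /= => ->; apply: Imx_mx_of.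
    apply/funext => i; apply/funext => j.
    by rewrite GammaInf_lactE mx_of_lact xN.
  suff : GammaInf_val (GammaInf_ract N p) = mx_of (crossed_ract x p).
    by rewrite /IS /= => ->; apply: Imx_mx_of.
  apply/funext => i; apply/funext => j.
  by rewrite GammaInf_ractE mx_of_ract xN.
Qed.

End Ideal.

(** * The isomorphism for l^oo, then its restriction to S *)

Section Map.
Variables (R : realType) (A : bornAlg R).
Local Open Scope ring_scope.

Definition crossed_mx (x : crossed (linf R) A) : GammaInf A :=
  MkGammaInf (asboolT (Imx_mx_of x)).

Lemma crossed_mx_add x y : crossed_mx (x + y) = crossed_mx x + crossed_mx y.
Proof. by apply: val_inj; rewrite /= mx_ofD. Qed.

Lemma crossed_mx_mul x y :
  crossed_mx (pa_mul x y) = pa_mul (crossed_mx x) (crossed_mx y).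
Proof. by apply: val_inj; apply: mx_of_mul. Qed.

Lemma crossed_mx_lact p x : crossed_mx (pa_lact p x) = pa_lact p (crossed_mx x).
Proof.
apply: GammaInf_ext => i j; rewrite [RHS]GammaInf_lactE.
exact: mx_of_lact.
Qed.

Lemma crossed_mx_ract p x : crossed_mx (pa_ract x p) = pa_ract (crossed_mx x) p.
Proof.
apply: GammaInf_ext => i j; rewrite [RHS]GammaInf_ractE.
exact: mx_of_ract.
Qed.

Definition crossed_mx_hom : palg_hom (crossed (linf R) A) (GammaInf A) :=
  PAlgHom crossed_mx_add crossed_mx_mul crossed_mx_lact crossed_mx_ract.

Lemma crossed_mx_inj : injective crossed_mx.
Proof. by move=> x y /(congr1 (@GammaInf_val R A)) /mx_of_inj. Qed.

Lemma crossed_mx_bij : bijective crossed_mx.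
Proof.
have surj (M : GammaInf A) : exists x, crossed_mx x = M.
  have /asboolP/mx_of_surj[x xM] : GammaInf_val M \in @GammaInf_mem R A by case: (M).
  by exists x; apply: val_inj.
have [g gK] := choice surj.
by exists g => // x; apply: crossed_mx_inj.
Qed.

End Map.

Unset Implicit Arguments.
Set Strict Implicit.

Theorem proposition6p12 (R : realType) (A : bornAlg R) :
  exists Phi : palg_hom (crossed (linf R) A) (GammaInf A),
    [/\ forall (a : seqS (linf R) A) (f : Emb),
          GammaInf_val (Phi (hash a (U f))) = diagU a f,
        bijective Phi
      & forall S : symIdeal R,
          [/\ palg_ideal (IS S A),
              injective (Phi \o crossed_incl S A)
            & range (Phi \o crossed_incl S A) = IS S A]].
Proof.
exists (crossed_mx_hom A); split=> [a f||S].
- exact: mx_of_hashU.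
- exact: crossed_mx_bij.
split.
- exact: IS_ideal.
(* The inclusion preserves matrices, and a tensor over S(A) is determined by its matrix. *)
- move=> x y /crossed_mx_inj /(congr1 (@mx_of R (linf R) A)).
  by rewrite !mx_of_incl => /mx_of_inj.
apply/seteqP; split=> [_ [x _ <-]|M /mx_of_surj[x xM]].
  by rewrite /IS /= mx_of_incl; apply: Imx_mx_of.
by exists x => //; apply: val_inj; rewrite /= mx_of_incl.
Qed.
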